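(* In the hierarchical Poisson model described in the context, with depth $D\in\mathbb{N}$ and branching numbers $n_1,\dots,n_D\in\mathbb{N}$, let $D_0\in\{1,\dots,D\}$ and let $$a_{D_0}^{(D_0)}=\frac12\prod_{d'=D_0+1}^Dn_{d'}.$$ Suppose that $n_{D'}\ge2$ for all $D'=1,\dots,D_0$. Suppose that $a_{D_0}^{(D_0)}\ge2$ and that $$\frac{2+D-D_0}{D_0-1}\,\frac{a_{D_0}^{(D_0)}-1}{a_{D_0}^{(D_0)}}\ \ge\ n_{D'}\,\frac{n_{D'-1}a_{D_0}^{(D_0)}}{n_{D'-1}a_{D_0}^{(D_0)}-2}$$ for all $D'=2,\dots,D_0$ (no condition if $D_0=1$). Then for any $D'=1,\dots,D_0$, under the entropy loss $\widetilde L^{\mathrm{KL}}$, $\hat\lambda^{(a^{(D_0)}(D'))}(X)$ is dominated by $\hat\lambda^{(a^{(D_0)}(D'-1))}(X)$. In particular, the Bayes estimator with respect to the Jeffreys prior and $X$ is dominated by the Bayes estimator with respect to $\pi^{(a^{(D_0)}(0))}$ and $X$.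
   Context: Model. For $d=0,1,\dots,D$ let $I_d=\prod_{d'=1}^d\{1,\dots,n_{d'}\}$ ($I_0$ contains only the empty tuple). The unknown parameter is $\boldsymbol\lambda=(\lambda_{i_1,\dots,i_D})_{(i_1,\dots,i_D)\in I_D}\in(0,\infty)^{n_1\cdots n_D}$. For $(i_1,\dots,i_d)\in I_d$ put $\lambda_{(i_1,\dots,i_d)}=\sum_{i_{d+1}=1}^{n_{d+1}}\cdots\sum_{i_D=1}^{n_D}\lambda_{i_1,\dots,i_D}$; for $d=0$ this is the total $\lambda$. One observes independent variables $X=(X_{(i_1,\dots,i_d)})_{(i_1,\dots,i_d)\in I_d,\ d=0,\dots,D}$ with $X_{(i_1,\dots,i_d)}\sim\mathrm{Po}(\lambda_{(i_1,\dots,i_d)})$ (Poisson with that mean). Loss. For $\tilde d=(\tilde d_{i_1,\dots,i_D})\in(0,\infty)^{n_1\cdots n_D}$ with $\tilde d_{(i_1,\dots,i_d)}=\sum_{i_{d+1}}\cdots\sum_{i_D}\tilde d_{i_1,\dots,i_D}$, $$\widetilde L^{\mathrm{KL}}(\tilde d,\boldsymbol\lambda)=\sum_{d=0}^D\sum_{(i_1,\dots,i_d)\in I_d}\lambda_{(i_1,\dots,i_d)}\Big(\frac{\tilde d_{(i_1,\dots,i_d)}}{\lambda_{(i_1,\dots,i_d)}}-1-\log\frac{\tilde d_{(i_1,\dots,i_d)}}{\lambda_{(i_1,\dots,i_d)}}\Big).$$ An estimator $\delta$ is dominated by $\delta'$ if $E_{\boldsymbol\lambda}[\widetilde L^{\mathrm{KL}}(\delta',\boldsymbol\lambda)]\le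 E_{\boldsymbol\lambda}[\widetilde L^{\mathrm{KL}}(\delta,\boldsymbol\lambda)]$ for all $\boldsymbol\lambda$, with strict inequality for at least one $\boldsymbol\lambda$. Estimators. Let $X_{(i_1,\dots,i_d,+)}=\sum_{d'=d}^D\sum_{i_{d+1}=1}^{n_{d+1}}\cdots\sum_{i_{d'}=1}^{n_{d'}}X_{(i_1,\dots,i_{d'})}$ (for $d=0$ written $X_{(+)}$). For $a=(a_0,\dots,a_D)\in(0,\infty)^{1+D}$, $\hat\lambda^{(a)}(X)$ has $(i_1,\dots,i_D)$ component $$\frac{X_{(+)}+a_0}{1+D}\prod_{d=1}^D\frac{X_{(i_1,\dots,i_d,+)}+a_d}{\sum_{i_d'=1}^{n_d}X_{(i_1,\dots,i_{d-1},i_d',+)}+n_da_d}.$$ It is the generalized Bayes estimator, under $\widetilde L^{\mathrm{KL}}$ and based on $X$, for the prior $\pi^{(a)}$ with density proportional to $\lambda^{a_0-1}\prod_{d=1}^D\prod_{(i_1,\dots,i_d)\in I_d}\theta_{(i_1,\dots,i_d)}^{a_d-1}$ in the coordinates $\lambda$ and $\theta_{(i_1,\dots,i_d)}=\lambda_{(i_1,\dots,i_d)}/\lambda_{(i_1,\dots,i_{d-1})}$. Hyperparameters. For $D_0\in\{1,\dots,D\}$ and $D'\in\{0,\dots,D_0\}$, $a^{(D_0)}(D')=(a_0,\dots,a_D)$ with $a_d=\frac12\prod_{d'=d+1}^D n_{d'}^{1(d'\le D'\text{ or }d'\ge D_0+1)}$ for $d=0,\dots,D_0-1$ and $a_d=\frac12\prod_{d'=d+1}^Dn_{d'}$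 for $d=D_0,\dots,D$ (empty products equal $1$; $1(\cdot)$ is the indicator). In particular $a^{(D_0)}(D_0)=(\frac12 n_{d+1}\cdots n_D)_{d=0,\dots,D}$ for every $D_0$, and $\pi^{(a^{(D_0)}(D_0))}$ is the Jeffreys prior. *)

(* Defs.v *)
From HB Require Import structures.
From mathcomp Require Import all_boot all_order all_algebra.
From mathcomp Require Import all_classical all_reals all_analysis.

Set Implicit Arguments.
Unset Strict Implicit.
Unset Printing Implicit Defensive.

Import Order.TTheory GRing.Theory Num.Theory.
Local Open Scope classical_set_scope.
Local Open Scope ring_scope.

(* I_d = {1..n_1} x ... x {1..n_d} as left-nested pairs, so that              *)
(* (i_1, ..., i_d, k) is [(i, k)] and its parent is [i.1].  The branching      *)
(* numbers are n 1, ..., n D (other values of n are irrelevant); the          *)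
(* coordinates themselves are numbered from 0.                                *)
Fixpoint idx (n : nat -> nat) (d : nat) : finType :=
  if d is d'.+1 then (idx n d' * 'I_(n d'.+1))%type else unit.

Fixpoint coords (n : nat -> nat) (d : nat) : idx n d -> seq nat :=
  match d return idx n d -> seq nat with
  | 0 => fun _ => [::]
  | d'.+1 => fun i => rcons (coords i.1) i.2
  end.

(* j = (i_1, ..., i_d, j_{d+1}, ..., j_d') for some j_{d+1}, ..., j_d' *)
Definition extends (n : nat -> nat) (d d' : nat) (i : idx n d) (j : idx n d') :
  bool := prefix (coords i) (coords j).

Definition node (n : nat -> nat) (D : nat) : finType :=
  {d : 'I_D.+1 & idx n d}.

Definition mknode (n : nat -> nat) (D : nat) (d : 'I_D.+1) (i : idx n d) :
  node n D := Tagged (fun d : 'I_D.+1 => idx n d : Type) i.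

Definition subtotal (R : realType) (n : nat -> nat) (D : nat)
    (f : idx n D -> R) (d : nat) (i : idx n d) : R :=
  \sum_(j : idx n D | extends i j) f j.

Definition pos_param (R : realType) (n : nat -> nat) (D : nat)
    (f : idx n D -> R) : Prop := forall i, 0 < f i.

Definition mutually_independent (R : realType) (dsp : measure_display)
    (Omega : measurableType dsp) (P : probability Omega R) (I : finType)
    (X : I -> {mfun Omega >-> nat}) : Prop :=
  forall (J : {set I}) (A : I -> set nat),
    P (\bigcap_(v in [set` J]) (X v @^-1` A v)) =
    (\prod_(v in J) P (X v @^-1` A v))%E.

Definition hierarchical_poisson_model (R : realType) (n : nat -> nat) (D : nat)
    (dsp : measure_display) (Omega : measurableType dsp)
    (P : (idx n D -> R) -> probability Omega R)
    (X : node n D -> {mfun Omega >-> nat}) : Prop :=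
  forall lam : idx n D -> R, pos_param lam ->
    mutually_independent (P lam) X /\
    forall (d : 'I_D.+1) (i : idx n d) (k : nat),
      P lam (X (mknode i) @^-1` [set k]) =
      (poisson_pmf (subtotal lam i) k)%:E.

Definition KL_loss (R : realType) (n : nat -> nat) (D : nat)
    (del lam : idx n D -> R) : R :=
  \sum_(d < D.+1) \sum_(i : idx n d)
    subtotal lam i * (subtotal del i / subtotal lam i - 1
                      - ln (subtotal del i / subtotal lam i)).

Definition estimator (R : realType) (n : nat -> nat) (D : nat) : Type :=
  (node n D -> nat) -> (idx n D -> R).

Definition risk (R : realType) (n : nat -> nat) (D : nat)
    (dsp : measure_display) (Omega : measurableType dsp)
    (P : (idx n D -> R) -> probability Omega R)
    (X : node n D -> {mfun Omega >-> nat})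
    (del : estimator R n D) (lam : idx n D -> R) : \bar R :=
  'E_(P lam)[fun w => KL_loss (del (fun v => X v w)) lam].

Definition risk_dominated_by (R : realType) (n : nat -> nat) (D : nat)
    (dsp : measure_display) (Omega : measurableType dsp)
    (P : (idx n D -> R) -> probability Omega R)
    (X : node n D -> {mfun Omega >-> nat})
    (del del' : estimator R n D) : Prop :=
  (forall lam, pos_param lam -> risk P X del' lam <= risk P X del lam)%E /\
  (exists2 lam, pos_param lam & risk P X del' lam < risk P X del lam)%E.

(* X_{(i_1, ..., i_d, +)} *)
Definition subtree_count (n : nat -> nat) (D : nat) (x : node n D -> nat)
    (d : nat) (i : idx n d) : nat :=
  (\sum_(d' < D.+1 | d <= d') \sum_(j : idx n d' | extends i j)
     x (mknode j))%N.

(* The product over depths 1, ..., d of the shrunken fractions along the path *)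
(* to i; the sum over k runs over i and its siblings.                         *)
Fixpoint fraction_prod (R : realType) (n : nat -> nat) (D : nat)
    (a : nat -> R) (x : node n D -> nat) (d : nat) : idx n d -> R :=
  match d return idx n d -> R with
  | 0 => fun _ => 1
  | d'.+1 => fun i =>
      fraction_prod a x i.1 *
      (((subtree_count x (i : idx n d'.+1))%:R + a d'.+1) /
       (\sum_(k < n d'.+1) (subtree_count x ((i.1, k) : idx n d'.+1))%:R
        + (n d'.+1)%:R * a d'.+1))
  end.

(* The estimator hat-lambda^(a), which is the generalized Bayes estimator     *)
(* under [KL_loss] for the prior with density proportional to                 *)
(* lambda^(a_0 - 1) * \prod_(d = 1..D) \prod_(i in I_d) theta_i^(a_d - 1).    *)
Definition lambda_hat (R : realType) (n : nat -> nat) (D : nat)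
    (a : nat -> R) : estimator R n D := fun x i =>
  ((subtree_count x (tt : idx n 0))%:R + a 0%N) / (1 + D%:R) *
  fraction_prod a x i.

(* For a = [jeffreys_hyper n D] the prior above is the Jeffreys prior.        *)
Definition jeffreys_hyper (R : realType) (n : nat -> nat) (D : nat) (d : nat) :
  R := 2^-1 * \prod_(d.+1 <= d' < D.+1) (n d')%:R.

(* a^(D0)(D'); the boolean exponent is the indicator. *)
Definition hyper (R : realType) (n : nat -> nat) (D D0 D' : nat) (d : nat) :
  R :=
  if (d < D0)%N then
    2^-1 * \prod_(d.+1 <= d' < D.+1)
             (n d')%:R ^+ ((d' <= D')%N || (D0.+1 <= d')%N)
  else 2^-1 * \prod_(d.+1 <= d' < D.+1) (n d')%:R.

(* Main.v *)
Require Import Defs.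
From mathcomp Require Import all_boot all_order all_algebra.
From mathcomp Require Import all_classical all_reals all_analysis.
From mathcomp Require Import measurable_realfun ring lra.
Import Order.TTheory GRing.Theory Num.Theory.
Local Open Scope ring_scope.

Set Implicit Arguments.
Unset Strict Implicit.
Unset Printing Implicit Defensive.

(* For a node u at depth d with intensity l_u, the count X_{u+} of its subtree
   and the count S_u of its proper descendants are Poisson with means
   (D+1-d) l_u and (D-d) l_u, and S_u <= X_{u+}.  Because the fractions at
   siblings add up to 1, the entropy loss of lambda-hat^(a) telescopes to a
   combination of ln (X_{u+} + a_d) and ln (S_u + n_{d+1} a_{d+1}).  Put
   D' = p + 1, a = a(D'), b = a(D'-1), g_d(z) = ln ((z + a_d) / (z + b_d)).  As
   n_{d+1} a_{d+1} = a_d for d < p (likewise for b) and a_0 - b_0 is the sum of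
   a_p - b_p over depth p, the risk difference is

     sum_{|v| = p} (a_p - b_p - (D+1-p) l_v E g_p(X_{v+}))
     - sum_{d < p} sum_{|u| = d}
         ((D+1-d) l_u E g_d(X_{u+}) - (D-d) l_u E g_d(S_u)).

   With Stein's identity mu E f(Z) = E (Z f(Z-1)) and ln x <= x - 1, the summands
   of the first sum are at least
     (a_p - b_p) (b_p - 1) / ((D+1-p) l_v + b_p - 1)
   and those of the second one at most
     (a_d - b_d) (a_d - 1) / ((D-d) ((D+1-d) l_u + b_d - 2)).
   By the harmonic-arithmetic mean inequality over the descendants of u at depth
   p, the hypothesis on the branching numbers makes each of the p inner sums less
   than a p-th of the first sum, so the risk decreases strictly at every
   parameter. *)

(** * Poisson variables: sums, Stein's identity, expected reciprocals *)

Section Poisson.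
Local Open Scope classical_set_scope.
Context {R : realType} {dsp : measure_display} {Omega : measurableType dsp}.
Variable P : probability Omega R.
Implicit Types (T : Omega -> nat) (mu : R) (f : nat -> R).

(* Agrees with [poisson_pmf mu k] for [mu > 0]; unlike it, also correct at
   [mu = 0], which the convolution argument needs for the empty sum. *)
Definition poisson_mass mu (k : nat) : R := mu ^+ k / k`!%:R * expR (- mu).

Lemma poisson_pmfE mu k : 0 < mu -> poisson_pmf mu k = poisson_mass mu k.
Proof. by rewrite /poisson_pmf /poisson_mass => ->. Qed.

Lemma poisson_mass_ge0 mu k : 0 <= mu -> 0 <= poisson_mass mu k.
Proof. by move=> mu0; rewrite !mulr_ge0 ?exprn_ge0 ?invr_ge0 ?expR_ge0. Qed.

(** The binomial theorem divided by k!. *)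
Lemma poisson_mass_conv mu nu k :
  \sum_(i < k.+1) poisson_mass mu (k - i) * poisson_mass nu i = poisson_mass (mu + nu) k.
Proof.
rewrite [RHS]/poisson_mass exprDn opprD expRD !mulr_suml; apply: eq_bigr => i _.
have ik : (i <= k)%N by rewrite -ltnS.
have F (m : nat) : m`!%:R != 0 :> R by rewrite pnatr_eq0 -lt0n fact_gt0.
rewrite /poisson_mass -(mulr_natr _ 'C(k, i)).
have -> : 'C(k, i)%:R = k`!%:R / (i`!%:R * (k - i)`!%:R) :> R.
  by rewrite -(bin_fact ik) -natrM natrM mulfK// natrM mulf_neq0.
by field; rewrite !F.
Qed.

Lemma poisson_mass_succ mu k : mu * poisson_mass mu k = k.+1%:R * poisson_mass mu k.+1.
Proof.
have F (m : nat) : m`!%:R != 0 :> R by rewrite pnatr_eq0 -lt0n fact_gt0.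
have k0 : k.+1%:R != 0 :> R by rewrite pnatr_eq0.
rewrite /poisson_mass factS natrM exprS; move: k.+1%:R k0 => c c0.
by field; rewrite F c0.
Qed.

Lemma measurable_sum_nat (I : Type) (s : seq I) (X : I -> {mfun Omega >-> nat}) :
  measurable_fun setT (fun w => (\sum_(v <- s) X v w)%N).
Proof.
elim: s => [|v s IH].
  by under eq_fun do rewrite big_nil; exact: measurable_cst.
under eq_fun do rewrite big_cons.
by apply: measurable_fun_addn => //; exact: measurable_funPT.
Qed.

Lemma measurable_preimage T (A : set nat) :
  measurable_fun setT T -> measurable (T @^-1` A).
Proof. by move=> mT; rewrite -[X in measurable X]setTI; exact: mT. Qed.

(* The sum is tracked jointly with events on the remaining variables, so that
   the induction never needs independence of the partial sums. *)
Lemma poisson_sum_joint (I : finType) (X : I -> {mfun Omega >-> nat})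
    (rate : I -> R) (s : seq I) :
  mutually_independent P X -> (forall v, 0 <= rate v) ->
  (forall v k, P (X v @^-1` [set k]) = (poisson_mass (rate v) k)%:E) ->
  uniq s ->
  forall (K : {set I}) (A : I -> set nat) (k : nat),
  {in s, forall v, v \notin K} ->
  P ([set w | (\sum_(v <- s) X v w)%N = k] `&`
     \bigcap_(v in [set` K]) (X v @^-1` A v)) =
  ((poisson_mass (\sum_(v <- s) rate v) k)%:E * \prod_(v in K) P (X v @^-1` A v))%E.
Proof.
move=> indep rate0 marg; elim: s => [|u s IH] /=.
  move=> _ K A k _; rewrite big_nil.
  have -> : [set w : Omega | (\sum_(v <- [::]) X v w)%N = k] =
            if k == 0%N then setT else set0.
    apply/seteqP; split => w /=; rewrite big_nil; first by move<-; rewrite eqxx.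
    by case: eqP => [->|].
  case: eqP => [->|/eqP k0].
    by rewrite setTI indep /poisson_mass expr0 fact0 oppr0 expR0 divr1 mulr1 mul1e.
  by rewrite set0I measure0 /poisson_mass expr0n (negPf k0) !mul0r mul0e.
move=> /andP[us uqs] K A k sK.
have uK : u \notin K by apply: sK; rewrite mem_head.
(* Fixing the value i of X_u splits the event for u :: s into disjoint events for s, with u moved
   into the set of tracked variables. *)
pose A' i v := if v == u then [set i] else A v.
pose F i := [set w | (\sum_(v <- s) X v w)%N = (k - i)%N] `&`
     \bigcap_(v in [set` u |: K]) (X v @^-1` A' i v).
have FE i w : F i w -> X u w = i.
  move=> [_ /(_ u)]; rewrite /= setU11 => /(_ isT).
  by rewrite /A' eqxx.
have -> : [set w | (\sum_(v <- u :: s) X v w)%N = k] `&`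
     \bigcap_(v in [set` K]) (X v @^-1` A v) = \big[setU/set0]_(i < k.+1) F i.
  rewrite -bigcup_mkord; apply/seteqP; split => w.
    move=> [/=]; rewrite big_cons => sk Kw; exists (X u w) => /=.
      by rewrite ltnS -sk leq_addr.
    split => /=; first by rewrite -sk addKn.
    move=> v /=; rewrite in_setU1 /A'; case: eqP => [->//|_ /= vK].
    exact: Kw.
  move=> [i /= ik Fiw]; have Xu := FE _ _ Fiw; case: Fiw => /= si Kw; split.
    by rewrite /= big_cons si Xu subnKC.
  move=> v /= vK; have /= := Kw v; rewrite in_setU1 vK orbT => /(_ isT).
  by rewrite /A'; case: eqP => // vu; move: uK; rewrite -vu vK.
rewrite measure_bigsetU_ord; last 2 first.
- move=> i; apply: measurableI.
    apply: (@measurable_preimage _ [set (k - i)%N]).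
    exact: measurable_sum_nat.
  apply: fin_bigcap_measurable => // v _; apply: measurable_preimage.
  exact: measurable_funPT.
- apply/trivIsetP => i j _ _ ij; rewrite -classical_sets.subset0 => w [/FE Xi /FE Xj].
  by move/eqP: ij; apply; apply: val_inj; rewrite /= -Xi -Xj.
have step (i : 'I_k.+1) : P (F i) =
  ((poisson_mass (\sum_(v <- s) rate v) (k - i) * poisson_mass (rate u) i)%:E *
   \prod_(v in K) P (X v @^-1` A v))%E.
  rewrite /F IH//; last first.
    move=> v vs; rewrite in_setU1 negb_or sK ?inE ?vs ?orbT// andbT.
    by apply: contraNneq us => <-.
  rewrite big_setU1//= {1}/A' eqxx marg muleA -EFinM; congr (_ * _)%E.
  apply: eq_bigr => v vK; rewrite /A'; case: eqP => // vu.
  by move: uK; rewrite -vu vK.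
rewrite (eq_bigr _ (fun i _ => step i)) -ge0_sume_distrl; last first.
  by move=> i _; rewrite lee_fin mulr_ge0 ?poisson_mass_ge0 ?sumr_ge0.
by rewrite sumEFin poisson_mass_conv big_cons addrC.
Qed.

Lemma poisson_sum (I : finType) (X : I -> {mfun Omega >-> nat})
    (rate : I -> R) (Q : pred I) (k : nat) :
  mutually_independent P X -> (forall v, 0 <= rate v) ->
  (forall v k, P (X v @^-1` [set k]) = (poisson_mass (rate v) k)%:E) ->
  P ((fun w => (\sum_(v | Q v) X v w)%N) @^-1` [set k]) =
  (poisson_mass (\sum_(v | Q v) rate v) k)%:E.
Proof.
move=> indep rate0 marg; rewrite -[\sum_(v | Q v) rate v]big_filter.
have := @poisson_sum_joint I X rate [seq v <- index_enum I | Q v] indep rate0 marg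
  (filter_uniq _ (index_enum_uniq I)) finset.set0 (fun=> setT) k.
rewrite big_set0 mule1 => <-; last by move=> v _; rewrite inE.
congr (P _); apply/seteqP; split => w /=; rewrite big_filter.
  by move=> ->; split => // v /=; rewrite inE.
by case.
Qed.

Lemma ge0_integral_nat T f : measurable_fun setT T -> (forall k, 0 <= f k) ->
  (\int[P]_w (f (T w))%:E = \sum_(k <oo) (f k)%:E * P (T @^-1` [set k]))%E.
Proof.
move=> mT f0; rewrite -[X in (\int[_]_(_ in X) _)%E](_ : \bigcup_k (T @^-1` [set k]) = setT);
  last by apply/seteqP; split => // w _; exists (T w).
rewrite ge0_integral_bigcup//.
- apply: eq_eseriesr => k _; rewrite -integral_cst; last exact: measurable_preimage.
  by apply: eq_integral => w; rewrite inE /= => ->.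
- by move=> k; exact: measurable_preimage.
- apply: measurable_funTS; apply/measurable_EFinP.
  exact: (@measurableT_comp _ _ _ _ _ _ f _ T).
- by move=> w _; rewrite lee_fin.
- by apply/trivIsetP => i j _ _ ij; rewrite -classical_sets.subset0 => w [/= Ti Tj]; move/eqP: ij; rewrite -Ti -Tj.
Qed.

(** The mean may be 0, as for the count of proper descendants of a leaf. *)
Definition poisson_rv T mu := [/\ measurable_fun setT T, 0 <= mu &
  forall k, P (T @^-1` [set k]) = (poisson_mass mu k)%:E].

(** The series is shifted by one, using that mu times the mass at k is k + 1 times the mass at k +
    1. In extended reals this needs no integrability. The convention [0.-1 = 0] is harmless, since
    the factor in front is then 0. *)
Lemma poisson_stein_ereal T mu f : poisson_rv T mu -> (forall k, 0 <= f k) ->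
  (mu%:E * \int[P]_w (f (T w))%:E =
   \int[P]_w ((T w)%:R * f (T w).-1)%:E)%E.
Proof.
move=> [mT mu0 pT] f0.
rewrite (ge0_integral_nat mT f0) (ge0_integral_nat (f := fun k => k%:R * f k.-1) mT);
  last by move=> k; rewrite mulr_ge0.
rewrite -nneseriesZl; last by move=> k _; rewrite mule_ge0// lee_fin.
rewrite [RHS]nneseries_recl//; last by move=> k _; rewrite mule_ge0// lee_fin mulr_ge0.
rewrite mul0r mul0e add0e -(nneseries_addn 1); last first.
  by move=> k; rewrite mule_ge0// lee_fin mulr_ge0.
apply: eq_eseriesr => k _; rewrite addn1 /= !pT -!EFinM; congr (_%:E).
by rewrite mulrCA poisson_mass_succ; ring.
Qed.

Lemma integrable_scale (g : Omega -> R) c : P.-integrable setT (EFin \o g) ->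
  P.-integrable setT (EFin \o (fun w => c * g w)).
Proof. by move=> ig; have := integrableZl measurableT c ig. Qed.

Lemma integrable_add (g h : Omega -> R) : P.-integrable setT (EFin \o g) ->
  P.-integrable setT (EFin \o h) ->
  P.-integrable setT (EFin \o (fun w => g w + h w)).
Proof. by move=> ig ih; have := integrableD measurableT ig ih. Qed.

Lemma poisson_expectation_ereal T mu : poisson_rv T mu ->
  (\int[P]_w ((T w)%:R)%:E = mu%:E)%E.
Proof.
move=> rvT; have := poisson_stein_ereal rvT (f := fun=> 1) (fun=> ler01).
rewrite integral_cst// [X in (_ * (_ * X))%E](_ : _ = 1%E).
  by rewrite !mule1 => ->; apply: eq_integral => w _; rewrite mulr1.
exact: probability_setT.
Qed.

(** The mean is finite, so at most linear growth is integrable. *)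
Lemma poisson_integrable T mu f C : poisson_rv T mu ->
  (forall k, `|f k| <= C * k.+1%:R) -> P.-integrable setT (EFin \o (f \o T)).
Proof.
move=> rvT fC; have [mT mu0 _] := rvT.
have mf (h : nat -> R) : measurable_fun setT (h \o T).
  exact: (@measurableT_comp _ _ _ _ _ _ h _ T).
have iT : P.-integrable setT (EFin \o (fun w => (T w)%:R)).
  apply/integrableP; split.
    by apply/measurable_EFinP; exact: (mf (fun k => k%:R)).
  under eq_integral do rewrite /= ger0_norm//.
  by rewrite (poisson_expectation_ereal rvT) ltry.
have i1 : P.-integrable setT (EFin \o (fun w => C * (T w).+1%:R)).
  apply: integrable_scale.
  have -> : (fun w => (T w).+1%:R) = (fun w => (T w)%:R + cst 1 w) :> (_ -> R).
    by apply/funext => w /=; rewrite natr1.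
  by apply: integrable_add => //; exact: finite_measure_integrable_cst.
apply: (le_integrable _ _ _ i1) => //.
- by apply/measurable_EFinP; exact: mf.
- move=> w _ /=; rewrite lee_fin; apply: le_trans (fC _) _; exact: ler_norm.
Qed.

Lemma bounded_integrable T mu f C : poisson_rv T mu ->
  (forall k, 0 <= f k <= C) -> P.-integrable setT (EFin \o (f \o T)).
Proof.
move=> rvT fC; apply: (poisson_integrable (C := C) rvT) => k.
have /andP[f0 fk] := fC k; rewrite ger0_norm// (le_trans fk)// ler_peMr//.
  exact: le_trans f0 fk.
by rewrite ler1n.
Qed.

Lemma stein_integrable T mu f C : poisson_rv T mu ->
  (forall k, 0 <= f k <= C) ->
  P.-integrable setT (EFin \o ((fun k => k%:R * f k.-1) \o T)).
Proof.
move=> rvT fC; apply: (poisson_integrable (C := C) rvT) => k.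
have /andP[f0 fk] := fC k.-1; rewrite ger0_norm ?mulr_ge0// mulrC ler_pM//.
by rewrite ler_nat.
Qed.

Lemma poisson_stein T mu f C : poisson_rv T mu ->
  (forall k, 0 <= f k <= C) ->
  mu * \int[P]_w f (T w) = \int[P]_w ((T w)%:R * f (T w).-1).
Proof.
move=> rvT fC; have := poisson_stein_ereal rvT (f := f) (fun k => proj1 (andP (fC k))).
rewrite /Rintegral => <-; rewrite fineM//.
have := bounded_integrable rvT fC; exact: integrable_fin_num.
Qed.

Lemma inv_shift_bounded (k : nat) (t : R) : 0 < t -> 0 <= (k%:R + t)^-1 <= t^-1.
Proof.
move=> t0; have kt : 0 < k%:R + t by rewrite ltr_wpDl.
by rewrite invr_ge0 ltW// lef_pV2 ?posrE// lerDr/=.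
Qed.

(** Stein's identity for 1/(z + t) writes (mu + t - 1) E 1/(T + t) as the expectation of T/(T - 1 +
    t) + (t - 1)/(T + t), the first term being 0 at T = 0. This is at most 1 pointwise. *)
Lemma expect_inv_le T mu (t : R) : poisson_rv T mu -> 1 <= t -> 0 < mu ->
  \int[P]_w ((T w)%:R + t)^-1 <= (mu + t - 1)^-1.
Proof.
move=> rvT t1 mu0; have t0 : 0 < t by exact: lt_le_trans t1.
have f1 k := inv_shift_bounded k t0.
rewrite -[leRHS]mul1r ler_pdivlMr; last lra.
have i1 := bounded_integrable rvT f1; have i2 := stein_integrable rvT f1.
have i3 := integrable_scale (t - 1) i1.
rewrite mulrC -addrA mulrDl (poisson_stein rvT f1) -RintegralZl//.
rewrite -RintegralD//.
have E1 : \int[P]_w (cst 1) w = 1 :> R.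
  rewrite /= Rintegral_cst// mul1r [X in fine X](_ : _ = 1%E)//.
  exact: probability_setT.
rewrite -[leRHS]E1; apply: le_Rintegral => //.
- exact: (integrable_add i2 i3).
- exact: finite_measure_integrable_cst.
move=> w _ /=; case: (T w) => [|k] /=.
  by rewrite mul0r !add0r ler_pdivrMr// mul1r gerBl.
have k0 : 0 <= k%:R :> R by [].
rewrite -natr1; move: (k%:R) k0 => x x0.
have -> : (x + 1) / (x + t) + (t - 1) / (x + 1 + t) =
  1 - (t - 1) / ((x + t) * (x + 1 + t)) by field; rewrite !lt0r_neq0//; lra.
by rewrite gerBl divr_ge0 ?mulr_ge0//; lra.
Qed.

Lemma ln_le_subr1 (x : R) : 0 < x -> ln x <= x - 1.
Proof. by move=> x0; rewrite -[x in ln x](subrK 1) addrC le_ln1Dx//; lra. Qed.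

(** * Bounds for the expected logarithms in the risk difference *)

Section LogRatio.
Variables a b : R.

(** This is g_d of the overview, for the values a and b at one depth. *)
Definition log_ratio (k : nat) : R := ln ((k%:R + a) / (k%:R + b)).

Lemma log_ratio_bound (b_le_a : b <= a) (b_gt0 : 0 < b) k :
  0 <= log_ratio k <= (a - b) / (k%:R + b).
Proof.
have kb : 0 < k%:R + b by rewrite ltr_wpDl.
apply/andP; split; first by rewrite ln_ge0// ler_pdivlMr// mul1r lerD2l.
have -> : (a - b) / (k%:R + b) = (k%:R + a) / (k%:R + b) - 1.
  by field; rewrite lt0r_neq0.
by apply: ln_le_subr1; rewrite divr_gt0// (lt_le_trans kb)// lerD2l.
Qed.

Lemma log_ratio_bounded (b_le_a : b <= a) (b_gt0 : 0 < b) k :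
  0 <= log_ratio k <= (a - b) / b.
Proof.
have /andP[-> h] := log_ratio_bound b_le_a b_gt0 k; apply: le_trans h _.
by rewrite ler_wpM2l ?subr_ge0// lef_pV2 ?posrE ?lerDr// ltr_wpDl.
Qed.

(** As ln x <= x - 1, the expected log ratio is at most (a - b) E 1/(T + b), which [expect_inv_le]
    bounds; then 1 - mu / (mu + b - 1) = (b - 1) / (mu + b - 1). *)
Lemma log_ratio_lower T mu : poisson_rv T mu -> 0 < mu -> 1 <= b -> b <= a ->
  (a - b) * ((b - 1) / (mu + b - 1)) <=
  (a - b) - mu * \int[P]_w log_ratio (T w).
Proof.
move=> rvT mu0 b1 ba; have b0 : 0 < b by exact: lt_le_trans b1.
have f1 k := inv_shift_bounded k b0.
have le1 : \int[P]_w log_ratio (T w) <= (a - b) * (mu + b - 1)^-1.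
  apply: (@le_trans _ _ (\int[P]_w ((a - b) * ((T w)%:R + b)^-1))).
    apply: le_Rintegral => //.
    - exact: (bounded_integrable rvT (log_ratio_bounded ba b0)).
    - by apply: integrable_scale; exact: (bounded_integrable rvT f1).
    - by move=> w _; have /andP[] := log_ratio_bound ba b0 (T w).
  rewrite RintegralZl//; last exact: (bounded_integrable rvT f1).
  by rewrite ler_wpM2l ?subr_ge0// (expect_inv_le rvT).
have -> : (a - b) * ((b - 1) / (mu + b - 1)) =
  (a - b) - mu * ((a - b) * (mu + b - 1)^-1) by field; rewrite lt0r_neq0//; lra.
by rewrite lerD2l lerN2 ler_wpM2l// ltW.
Qed.

(* The increments of [z * log_ratio (z - 1)] are dominated by those of
   [- (a - b) * (a - 1) / (z + b - 1)]. *)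
Lemma log_ratio_incr k : 1 < b -> b <= a ->
  k.+1%:R * log_ratio k + (a - b) * (a - 1) / (k.+1%:R + b - 1) <=
  k%:R * log_ratio k.-1 + (a - b) * (a - 1) / (k%:R + b - 1).
Proof.
move=> b1 ba; have b0 : 0 < b by exact: lt_trans b1.
case: k => [|k] /=.
  (* At k = 0 the claim reduces to a / b <= (a - 1) / (b - 1), which holds as 1 < b <= a. *)
  have /andP[_] := log_ratio_bound ba b0 0; rewrite mul0r !add0r mul1r => h.
  have -> : 1 + b - 1 = b by ring.
  apply: (@le_trans _ _ ((a - b) / b + (a - b) * (a - 1) / b)); first by rewrite lerD2r.
  have -> : (a - b) / b + (a - b) * (a - 1) / b = (a - b) * (a / b).
    by field; rewrite lt0r_neq0.
  rewrite -mulrA ler_wpM2l ?subr_ge0// ler_pdivrMr// mulrAC ler_pdivlMr; last lra.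
  nra.
(* With g the log ratio, (k + 2) g(k + 1) - (k + 1) g(k) is g(k + 1) plus (k + 1) times an increment
   of g; ln x <= x - 1 bounds both parts. *)
have /andP[_] := log_ratio_bound ba b0 k.+1.
have : log_ratio k.+1 - log_ratio k <=
   - (a - b) / ((k.+1%:R + b) * (k.+1%:R + a - 1)).
  have p0 (c : R) (j : nat) : 0 < c -> 0 < j%:R + c by move=> c0; rewrite ltr_wpDl.
  have a0 : 0 < a by lra.
  rewrite /log_ratio -ln_div ?posrE ?divr_gt0 ?p0//.
  have -> : - (a - b) / ((k.+1%:R + b) * (k.+1%:R + a - 1)) =
    (k.+1%:R + a) / (k.+1%:R + b) / ((k%:R + a) / (k%:R + b)) - 1.
    have := p0 _ k a0; have := p0 _ k b0; rewrite -natr1; move: (k%:R) => x xb xa.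
    by field; rewrite !lt0r_neq0//; lra.
  by apply: ln_le_subr1; rewrite !divr_gt0 ?p0.
have k0 : 0 <= k%:R :> R by [].
move: (log_ratio k.+1) (log_ratio k) => G g; rewrite -!natr1; move: (k%:R) k0 => x x0.
move=> h1 h2.
have -> : x + 1 + 1 + b - 1 = x + 1 + b by ring.
apply: (@le_trans _ _ ((x + 1) * g + (a - b) / (x + 1 + b)
  + (x + 1) * (- (a - b) / ((x + 1 + b) * (x + 1 + a - 1)))
  + (a - b) * (a - 1) / (x + 1 + b))); first nra.
rewrite -!addrA lerD2l.
have xp (c : R) : 1 < c -> 0 < x + c by lra.
(* Once (a - b)(a - 1) is factored out, there remains (x + 1 + a)(x + b) <= (x + 1 + b)(x + a), that
   is b <= a. *)
have -> : (a - b) / (x + (1 + b)) + ((x + 1) * (- (a - b) / ((x + (1 + b)) * (x + (1 + (a - 1)))))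
  + (a - b) * (a - 1) / (x + (1 + b)))
  = (a - b) * (a - 1) * ((x + (1 + b)) * (x + a))^-1 * (1 + x + a).
  by field; rewrite !lt0r_neq0//; lra.
have -> : x + (1 + (b - 1)) = x + b by ring.
rewrite -!mulrA ler_wpM2l ?subr_ge0// ler_wpM2l//; first lra.
rewrite mulrC ler_pdivrMr; last by rewrite mulr_gt0//; lra.
rewrite mulrC ler_pdivlMr; last lra.
nra.
Qed.

(** The pointwise order Z <= W stands in for the joint law. Stein's identity turns both terms into
    expectations of z g(z - 1), whose increase is paid for by the decrease of (a - b)(a - 1) / (z +
    b - 1). A second use of the identity compares the two expected reciprocals. *)
Lemma log_ratio_upper Z W (p q : R) : poisson_rv Z p -> poisson_rv W q ->
  0 < p -> p <= q -> (forall w, (Z w <= W w)%N) -> 2 <= b -> b <= a ->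
  q * \int[P]_w log_ratio (W w) - p * \int[P]_w log_ratio (Z w) <=
  (a - b) * (a - 1) * ((q - p) / p / (q + b - 2)).
Proof.
move=> rvZ rvW p0 pq0 ZW b2 ba; have q0 : 0 < q by exact: lt_le_trans pq0.
have b0 : 0 < b by lra.
have lb := log_ratio_bounded ba b0.
have b10 : 0 < b - 1 by lra.
have f1 k := inv_shift_bounded k b10.
pose K := (a - b) * (a - 1).
have iS T mu : poisson_rv T mu ->
    P.-integrable setT (EFin \o (fun w => K * ((T w)%:R + (b - 1))^-1)).
  by move=> rvT; apply: integrable_scale; exact: (bounded_integrable rvT f1).
have ES T mu : poisson_rv T mu ->
    \int[P]_w ((T w)%:R * log_ratio (T w).-1 + K * ((T w)%:R + (b - 1))^-1)
    = mu * \int[P]_w log_ratio (T w) + K * \int[P]_w ((T w)%:R + (b - 1))^-1.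
  move=> rvT; rewrite RintegralD//; last 2 first.
  - exact: (stein_integrable rvT lb).
  - exact: (iS _ _ rvT).
  by rewrite (poisson_stein rvT lb) RintegralZl//; exact: (bounded_integrable rvT f1).
have mono : q * \int[P]_w log_ratio (W w) + K * \int[P]_w ((W w)%:R + (b - 1))^-1
   <= p * \int[P]_w log_ratio (Z w) + K * \int[P]_w ((Z w)%:R + (b - 1))^-1.
  rewrite -(ES _ _ rvW) -(ES _ _ rvZ).
  have iT T mu (rvT : poisson_rv T mu) : P.-integrable setT (EFin \o (fun w =>
      (T w)%:R * log_ratio (T w).-1 + K * ((T w)%:R + (b - 1))^-1)).
    by apply: integrable_add; [exact: (stein_integrable rvT lb)|exact: (iS _ _ rvT)].
  apply: le_Rintegral => //; [exact: (iT _ _ rvW)|exact: (iT _ _ rvZ)|].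
  move=> w _; move: (W w) (Z w) (ZW w) => m k /subnK <-.
  elim: (m - k)%N => [|j IH]; first by rewrite add0n.
  apply: le_trans IH; rewrite addSn /= !addrA; apply: log_ratio_incr => //; lra.
(* By Stein's identity both sides are expectations of z / (z + b - 2), read as 0 at z = 0; this is
   nondecreasing because b >= 2. *)
have pq : p * \int[P]_w ((Z w)%:R + (b - 1))^-1 <= q * \int[P]_w ((W w)%:R + (b - 1))^-1.
  rewrite (poisson_stein rvZ f1) (poisson_stein rvW f1).
  apply: le_Rintegral => //; [exact: (stein_integrable rvZ f1)|exact: (stein_integrable rvW f1)|].
  move=> w _; move: (W w) (Z w) (ZW w) => m k; case: k => [|k] km /=.
    by rewrite mul0r mulr_ge0//; case/andP: (f1 m.-1).
  case: m km => // m; rewrite ltnS -(ler_nat R) => km /=.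
  have k0 : 0 <= k%:R :> R by [].
  rewrite -!natr1; move: (k%:R) (m%:R) k0 km => x y x0 xy.
  rewrite ler_pdivrMr; last lra.
  rewrite mulrAC ler_pdivlMr; [nra|lra].
have wb := expect_inv_le rvW (t := b - 1) ltac:(lra) q0.
have K0 : 0 <= K by rewrite mulr_ge0//; lra.
move: wb pq mono; move: (\int[P]_w ((W w)%:R + (b - 1))^-1)%R (\int[P]_w ((Z w)%:R + (b - 1))^-1)%R => iW iZ.
move: (\int[P]_w log_ratio (W w))%R (\int[P]_w log_ratio (Z w))%R => gW gZ.
have -> : q + (b - 1) - 1 = q + b - 2 by ring.
move=> wb pq mono.
apply: (@le_trans _ _ (K * (iZ - iW))); first lra.
(* [pq] gives iZ <= (q / p) iW, hence the factor (q - p) / p. *)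
rewrite ler_wpM2l//; apply: (@le_trans _ _ ((q - p) / p * iW)); last first.
  by rewrite ler_wpM2l// divr_ge0 ?subr_ge0// ltW.
have -> : (q - p) / p * iW = (q * iW) / p - iW by field; rewrite lt0r_neq0.
by rewrite lerD2r ler_pdivlMr// mulrC.
Qed.

End LogRatio.
End Poisson.

(** * Sums over the levels of the tree *)

Section Tree.
Variable n : nat -> nat.

Lemma size_coords d (i : idx n d) : size (coords i) = d.
Proof. by elim: d i => //= d IH i; rewrite size_rcons IH. Qed.

Lemma coords_inj d : injective (@coords n d).
Proof.
elim: d => [[] []//|d IH] [i k] [j l] /= /rcons_inj[/IH -> kl].
by congr pair; exact: val_inj.
Qed.

Lemma extends_same d (i j : idx n d) : extends i j = (j == i).
Proof.
rewrite /extends prefixE take_oversize ?size_coords//.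
by rewrite (inj_eq (@coords_inj d)).
Qed.

Lemma extends_parent d e (i : idx n d) (j : idx n e.+1) :
  (d <= e)%N -> extends i j = extends i j.1.
Proof.
move=> de; rewrite /extends !prefixE /= size_coords -cats1 takel_cat//.
by rewrite size_coords.
Qed.

Lemma extends_root e (j : idx n e) : extends (tt : idx n 0) j.
Proof. by rewrite /extends prefixE take0. Qed.

(** * Regrouping over descendants, for sums in [nat] and in [R] alike *)

Section Big.
Context {V : Type} {idv : V} {op : Monoid.com_law idv}.

Lemma big_extends_recr d e (i : idx n d) (F : idx n e.+1 -> V) : (d <= e)%N ->
  \big[op/idv]_(j : idx n e.+1 | extends i j) F j =
  \big[op/idv]_(j : idx n e | extends i j) \big[op/idv]_(k < n e.+1) F (j, k).
Proof.
move=> de; rewrite pair_big_dep /=; apply: eq_big => [[j k]|[j k] _//] /=.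
by rewrite andbT (@extends_parent _ _ _ (j, k)).
Qed.

Lemma big_extends_same d (i : idx n d) (F : idx n d -> V) :
  \big[op/idv]_(j : idx n d | extends i j) F j = F i.
Proof. by under eq_bigl do rewrite extends_same; rewrite big_pred1_eq. Qed.

(** Every node at depth f below i passes through exactly one node at depth e; induction on f peels
    off the last coordinate. *)
Lemma big_extends_tower d e f (i : idx n d) (F : idx n f -> V) :
  (d <= e <= f)%N ->
  \big[op/idv]_(j : idx n e | extends i j)
    \big[op/idv]_(l : idx n f | extends j l) F l =
  \big[op/idv]_(l : idx n f | extends i l) F l.
Proof.
move=> /andP[de]; elim: f F => [|f IH] F.
  rewrite leqn0 => /eqP e0; subst e; apply: eq_bigr => j _.
  by rewrite big_extends_same.
rewrite leq_eqVlt => /predU1P[ef|]; first subst e.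
  by apply: eq_bigr => j _; rewrite big_extends_same.
rewrite ltnS => ef; rewrite big_extends_recr ?(leq_trans de)// -IH//.
by apply: eq_bigr => j _; rewrite big_extends_recr.
Qed.

Lemma big_extends_children d f (i : idx n d) (F : idx n f -> V) : (d < f)%N ->
  \big[op/idv]_(k < n d.+1)
    \big[op/idv]_(l : idx n f | extends ((i, k) : idx n d.+1) l) F l =
  \big[op/idv]_(l : idx n f | extends i l) F l.
Proof.
move=> df; rewrite -(@big_extends_tower _ d.+1)//; last by rewrite leqnSn.
by rewrite big_extends_recr// big_extends_same.
Qed.

Lemma big_extends_root f (F : idx n f -> V) :
  \big[op/idv]_(l : idx n f | extends (tt : idx n 0) l) F l =
  \big[op/idv]_(l : idx n f) F l.
Proof. by apply: eq_bigl => j; rewrite extends_root. Qed.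

Lemma big_level_tower d f (F : idx n f -> V) : (d <= f)%N ->
  \big[op/idv]_(j : idx n d) \big[op/idv]_(l : idx n f | extends j l) F l =
  \big[op/idv]_(l : idx n f) F l.
Proof.
by move=> df; rewrite -big_extends_root big_extends_tower// big_extends_root.
Qed.

Lemma big_levels_node D d (Q : pred nat) (i : idx n d)
    (F : forall e : nat, idx n e -> V) :
  \big[op/idv]_(e < D.+1 | Q e) \big[op/idv]_(j : idx n e | extends i j) F e j =
  \big[op/idv]_(v : node n D | Q (tag v) && extends i (tagged v))
    F (tag v) (tagged v).
Proof. by rewrite sig_big_dep. Qed.

End Big.

Lemma card_extends d e (i : idx n d) : (d <= e)%N ->
  (\sum_(j : idx n e | extends i j) 1 = \prod_(d.+1 <= k < e.+1) n k)%N.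
Proof.
elim: e => [|e IH].
  by rewrite leqn0 => /eqP d0; subst d; rewrite big_extends_same big_geq.
rewrite leq_eqVlt => /predU1P[de|]; first subst d.
  by rewrite big_extends_same big_geq.
rewrite ltnS => de; rewrite big_extends_recr// big_nat_recr//= -IH//.
rewrite big_distrl /=; apply: eq_bigr => j _.
by rewrite sum_nat_const card_ord muln1 mul1n.
Qed.

Variable D : nat.

Definition below_count (x : node n D -> nat) d (i : idx n d) : nat :=
  (\sum_(d' < D.+1 | d < d') \sum_(j : idx n d' | extends i j) x (mknode j))%N.

(** Each proper descendant of i lies below exactly one child. Hence the denominators of the
    estimator depend on the counts S_u of the overview. *)
Lemma sum_subtree_count (x : node n D -> nat) d (i : idx n d) :
  (\sum_(k < n d.+1) subtree_count x ((i, k) : idx n d.+1) = below_count x i)%N.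
Proof.
rewrite /subtree_count exchange_big /=; apply: eq_bigr => e de.
by rewrite big_extends_children.
Qed.

(** A single sum over nodes is the shape to which the Poisson law of a sum applies; the next lemma
    serves the same purpose. *)
Lemma subtree_countE (x : node n D -> nat) d (i : idx n d) :
  subtree_count x i =
  (\sum_(v : node n D | (d <= tag v) && extends i (tagged v)) x v)%N.
Proof.
rewrite /subtree_count sig_big_dep /=; apply: eq_bigr => -[e j] _ //.
Qed.

Lemma below_countE (x : node n D -> nat) d (i : idx n d) :
  below_count x i =
  (\sum_(v : node n D | (d < tag v) && extends i (tagged v)) x v)%N.
Proof.
rewrite /below_count sig_big_dep /=; apply: eq_bigr => -[e j] _ //.
Qed.

Lemma below_count_le (x : node n D -> nat) d (i : idx n d) :
  (below_count x i <= subtree_count x i)%N.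
Proof.
rewrite below_countE subtree_countE big_mkcond [leqRHS]big_mkcond /=.
apply: leq_sum => v _; case: (ltnP d (tag v)) => //= /ltnW -> //.
Qed.

Variable R : realType.
Implicit Types (lam : idx n D -> R).

Lemma sum_subtotal lam d e (i : idx n d) : (d <= e <= D)%N ->
  \sum_(j : idx n e | extends i j) subtotal lam j = subtotal lam i.
Proof. exact: big_extends_tower. Qed.

Lemma sum_subtotal_children lam d (i : idx n d) : (d < D)%N ->
  \sum_(k < n d.+1) subtotal lam ((i, k) : idx n d.+1) = subtotal lam i.
Proof. exact: big_extends_children. Qed.

Lemma sum_level_subtotal lam d : (d <= D)%N ->
  \sum_(i : idx n d) subtotal lam i = subtotal lam (tt : idx n 0).
Proof. by move=> dD; rewrite big_level_tower// -big_extends_root. Qed.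

(** On each of the D + 1 - d0 levels from d0 to D, the descendants of i carry the full intensity of
    i. The choices d0 = d and d0 = d + 1 give the means of X_{u+} and S_u. *)
Lemma node_rate (lam : idx n D -> R) d d0 (i : idx n d) : (d <= d0 <= D.+1)%N ->
  \sum_(v : node n D | (d0 <= tag v)%N && extends i (tagged v)) subtotal lam (tagged v)
  = (D.+1 - d0)%:R * subtotal lam i.
Proof.
move=> /andP[dd0 d0D].
rewrite -(big_levels_node D (fun e : nat => (d0 <= e)%N) i (fun e j => subtotal lam j)).
transitivity (\sum_(e < D.+1 | (d0 <= e)%N) subtotal lam i).
  apply: eq_bigr => e de; apply: sum_subtotal.
  by rewrite (leq_trans dd0 de) -ltnS ltn_ord.
rewrite -(big_mkord (fun e : nat => (d0 <= e)%N) (fun=> subtotal lam i)).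
rewrite -(@big_nat_widenl _ _ _ _ _ _ xpredT)// sumr_const_nat mulr_natl.
by [].
Qed.

End Tree.

(** * The loss in terms of subtree counts *)

Section Loss.
Variables (R : realType) (n : nat -> nat) (D : nat).
Hypothesis n_ge1 : forall d, (1 <= d <= D)%N -> (1 <= n d)%N.
Implicit Types (lam : idx n D -> R) (a : nat -> R) (x : node n D -> nat).

Lemma sum_siblings a x d (i : idx n d) :
  \sum_(k < n d.+1) ((subtree_count x ((i, k) : idx n d.+1))%:R + a d.+1) =
  (below_count x i)%:R + (n d.+1)%:R * a d.+1 :> R.
Proof.
by rewrite big_split /= -natr_sum sum_subtree_count sumr_const card_ord mulr_natl.
Qed.

Lemma fraction_prodS a x d (i : idx n d) (k : 'I_(n d.+1)) :
  fraction_prod a x ((i, k) : idx n d.+1) = fraction_prod a x i *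
  (((subtree_count x ((i, k) : idx n d.+1))%:R + a d.+1) /
   ((below_count x i)%:R + (n d.+1)%:R * a d.+1)).
Proof. by rewrite /= -natr_sum sum_subtree_count. Qed.

Lemma siblings_gt0 a x d (i : idx n d) : (forall d, 0 < a d) -> (d < D)%N ->
  0 < (below_count x i)%:R + (n d.+1)%:R * a d.+1.
Proof. by move=> a0 dD; rewrite ltr_wpDl// mulr_gt0// ltr0n n_ge1. Qed.

Lemma fraction_prod_gt0 a x d (i : idx n d) : (forall d, 0 < a d) -> (d <= D)%N ->
  0 < fraction_prod a x i.
Proof.
move=> a0; elim: d i => [|d IH] // [i k] dD.
rewrite fraction_prodS mulr_gt0 ?IH ?(ltnW dD)// divr_gt0 ?siblings_gt0//.
by rewrite ltr_wpDl.
Qed.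

(** The fractions at siblings add up to 1, so each level collapses onto the one above it. *)
Lemma sum_fraction_prod a x d e (i : idx n d) : (forall d, 0 < a d) ->
  (d <= e <= D)%N ->
  \sum_(j : idx n e | extends i j) fraction_prod a x j = fraction_prod a x i.
Proof.
move=> a0 /andP[]; elim: e => [|e IH].
  by rewrite leqn0 => /eqP d0; subst d; rewrite big_extends_same.
rewrite leq_eqVlt => /predU1P[de|]; first by subst d; rewrite big_extends_same.
rewrite ltnS => de eD; rewrite big_extends_recr// -IH// ?(ltnW eD)//.
apply: eq_bigr => j _; under eq_bigr do rewrite fraction_prodS.
rewrite -mulr_sumr -mulr_suml sum_siblings divff ?mulr1//.
by rewrite lt0r_neq0// siblings_gt0.
Qed.

Lemma subtotal_lambda_hat a x d (i : idx n d) : (forall d, 0 < a d) ->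
  (d <= D)%N -> subtotal (lambda_hat a x) i =
  ((subtree_count x (tt : idx n 0))%:R + a 0) / (1 + D%:R) * fraction_prod a x i.
Proof.
move=> a0 dD; rewrite /subtotal /lambda_hat -mulr_sumr sum_fraction_prod//.
by rewrite dD leqnn.
Qed.

Lemma sum_level0 (V : nmodType) (F : idx n 0 -> V) : \sum_i F i = F tt.
Proof. by rewrite -big_extends_root big_extends_same. Qed.

Lemma sum_levelS (V : nmodType) d (F : idx n d.+1 -> V) :
  \sum_i F i = \sum_(i : idx n d) \sum_(k < n d.+1) F (i, k).
Proof. by rewrite -big_extends_root big_extends_recr// big_extends_root. Qed.

(** Together with [sibling_term], this collects the logarithms of the numerators at depth d and of
    the denominators at depth d + 1. *)
Definition count_term lam a x d : R :=
  \sum_(i : idx n d) subtotal lam i * ln ((subtree_count x i)%:R + a d).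

Definition sibling_term lam a x d : R :=
  \sum_(i : idx n d) subtotal lam i *
    ln ((below_count x i)%:R + (n d.+1)%:R * a d.+1).

Lemma sum_ln_fraction_prod lam a x d : (forall d, 0 < a d) -> (d < D)%N ->
  \sum_(i : idx n d.+1) subtotal lam i * ln (fraction_prod a x i) =
  \sum_(i : idx n d) subtotal lam i * ln (fraction_prod a x i)
  + (count_term lam a x d.+1 - sibling_term lam a x d).
Proof.
move=> a0 dD; rewrite /count_term /sibling_term !sum_levelS -sumrB -big_split.
apply: eq_bigr => i _; rewrite -(sum_subtotal_children _ i dD) !mulr_suml.
rewrite -sumrB -big_split; apply: eq_bigr => k _.
have c0 : 0 < (subtree_count x ((i, k) : idx n d.+1))%:R + a d.+1 by rewrite ltr_wpDl.
have s0 := @siblings_gt0 a x d i a0 dD.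
have f0 := @fraction_prod_gt0 a x d i a0 (ltnW dD).
rewrite fraction_prodS lnM ?posrE ?divr_gt0// ln_div ?posrE//.
by rewrite -mulrBr mulrDr.
Qed.

(** The increment G d enters every later U e, hence m - d of the sums; the weights D - d of the loss
    arise here. *)
Lemma sum_partial_sums (U G : nat -> R) m : U 0%N = 0 ->
  (forall d, (d < m)%N -> U d.+1 = U d + G d) ->
  \sum_(d < m.+1) U d = \sum_(d < m) (m - d)%:R * G d.
Proof.
move=> U0; elim: m => [|m IH] US; first by rewrite big_ord1 big_ord0.
rewrite big_ord_recr /= IH; last by move=> d dm; apply: US; exact: ltnW.
have -> : U m.+1 = \sum_(d < m.+1) G d.
  have: (m.+1 <= m.+1)%N by [].
  elim: {-2}m.+1 => [|j IHj] jm; first by rewrite big_ord0.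
  by rewrite US// big_ord_recr /= IHj// ltnW.
rewrite [RHS]big_ord_recr [X in _ + X = _]big_ord_recr /= addrA -big_split /=.
rewrite subSnn mul1r; congr (_ + _); apply: eq_bigr => d _.
by rewrite subSn 1?ltnW// -natr1 mulrDl mul1r.
Qed.

(** The part of the loss free of data and hyperparameters, which cancels in differences. Its last
    summand comes from the divisor 1 + D of the estimator. *)
Definition entropy_term lam : R :=
  \sum_(d < D.+1) \sum_(i : idx n d)
     (subtotal lam i * ln (subtotal lam i) - subtotal lam i)
  + D.+1%:R * subtotal lam (tt : idx n 0) * ln D.+1%:R.

Lemma extends_witness d e (i : idx n d) : (d <= e <= D)%N ->
  exists j : idx n e, extends i j.
Proof.
move=> /andP[de eD]; have : (0 < \sum_(j : idx n e | extends i j) 1)%N.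
  rewrite card_extends// big_nat_cond prodn_cond_gt0// => k.
  rewrite andbT => /andP[dk ke]; apply: n_ge1.
  by rewrite (leq_ltn_trans _ dk)// (leq_trans _ eD).
rewrite lt0n; case: (pickP (fun j : idx n e => extends i j)) => [j ij _|no].
  by exists j.
by rewrite big_pred0.
Qed.

Lemma subtotal_gt0 lam d (i : idx n d) : pos_param lam -> (d <= D)%N ->
  0 < subtotal lam i.
Proof.
move=> lam0 dD; have [|j ij] := @extends_witness d D i; first by rewrite dD /=.
rewrite /subtotal (bigD1 j)//= ltr_wpDr// sumr_ge0// => k _; exact: ltW.
Qed.

Lemma KL_loss_lambda_hat lam a x : pos_param lam -> (forall d, 0 < a d) ->
  KL_loss (lambda_hat a x) lam =
  entropy_term lam + (a 0 + (subtree_count x (tt : idx n 0))%:R)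
  - \sum_(d < D.+1) (D.+1 - d)%:R * count_term lam a x d
  + \sum_(d < D) (D - d)%:R * sibling_term lam a x d.
Proof.
move=> lam0 a0.
pose M : R := (subtree_count x (tt : idx n 0))%:R + a 0.
pose L := subtotal lam (tt : idx n 0).
pose U d := \sum_(i : idx n d) subtotal lam i * ln (fraction_prod a x i).
have M0 : 0 < M by rewrite ltr_wpDl.
have D1E : 1 + D%:R = D.+1%:R :> R by rewrite nat1r.
have D1 : 0 < 1 + D%:R :> R by rewrite D1E.
(* The estimates on each level add up to M / (1 + D), so the D + 1 levels together give M. The
   logarithms split into the common ln M and the sums U d. *)
have level (d : 'I_D.+1) : \sum_(i : idx n d)
    subtotal lam i * (subtotal (lambda_hat a x) i / subtotal lam i - 1
                      - ln (subtotal (lambda_hat a x) i / subtotal lam i)) =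
  M / (1 + D%:R) - L * (ln M - ln D.+1%:R) - U d
   + \sum_(i : idx n d) (subtotal lam i * ln (subtotal lam i) - subtotal lam i).
  have dD : (d <= D)%N by rewrite -ltnS.
  transitivity (\sum_(i : idx n d) (M / (1 + D%:R) * fraction_prod a x i
     - subtotal lam i * (ln M - ln D.+1%:R) - subtotal lam i * ln (fraction_prod a x i)
     + (subtotal lam i * ln (subtotal lam i) - subtotal lam i))).
    apply: eq_bigr => i _; have l0 := subtotal_gt0 i lam0 dD.
    have f0 := @fraction_prod_gt0 a x d i a0 dD.
    rewrite subtotal_lambda_hat// -/M ln_div ?posrE ?mulr_gt0 ?invr_gt0//.
    rewrite lnM ?posrE ?divr_gt0// ln_div ?posrE// D1E.
    by field; rewrite !lt0r_neq0// D1E.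
  rewrite big_split /= !sumrB -mulr_sumr -mulr_suml -(big_extends_root (fraction_prod a x (d := d))).
  by rewrite sum_fraction_prod// mulr1 sum_level_subtotal.
rewrite /KL_loss (eq_bigr _ (fun d _ => level d)) big_split /= sumrB sumr_const card_ord.
rewrite (@sum_partial_sums U (fun d => count_term lam a x d.+1 - sibling_term lam a x d));
  last 2 first.
- by rewrite /U sum_level0 /= ln1 mulr0.
- by move=> d dD; exact: sum_ln_fraction_prod.
(* The root term is (D + 1) L ln M; below it the index shift turns D + 1 - (d + 1) into D - d. *)
have -> : \sum_(d < D.+1) (D.+1 - d)%:R * count_term lam a x d =
    D.+1%:R * (L * ln M) + \sum_(d < D) (D - d)%:R * count_term lam a x d.+1.
  rewrite big_ord_recl subn0 {1}/count_term sum_level0 -/M -/L; congr (_ + _).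
have -> : \sum_(d < D) (D - d)%:R * (count_term lam a x d.+1 - sibling_term lam a x d) =
    \sum_(d < D) (D - d)%:R * count_term lam a x d.+1
    - \sum_(d < D) (D - d)%:R * sibling_term lam a x d.
  by rewrite -sumrB; apply: eq_bigr => d _; rewrite mulrBr.
rewrite /entropy_term -/L -[X in X - _ + _ = _]mulr_natl -D1E /M.
by field; rewrite lt0r_neq0.
Qed.

End Loss.

(** * Comparison of two consecutive hyperparameters *)

(** The convex function 1/z lies above its tangent 2t - t^2 z at z = 1/t. Take 1/t to be the mean of
    the y_i and sum. *)
Lemma harmonic_sum_ge (R : realFieldType) (I : finType) (Q : pred I) (y : I -> R) :
  (forall i, Q i -> 0 < y i) -> (exists i, Q i) ->
  (\sum_(i | Q i) 1)%:R ^+ 2 / \sum_(i | Q i) y i <= \sum_(i | Q i) (y i)^-1.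
Proof.
move=> y0 [i0 Qi0]; set N := (_%:R : R); set S := \sum_(i | Q i) y i.
have N0 : 0 < N by rewrite ltr0n lt0n sum_nat_eq0 negb_forall_in; apply/existsP; exists i0; rewrite Qi0.
have S0 : 0 < S.
  by rewrite /S (bigD1 i0)//= ltr_wpDr ?y0// sumr_ge0// => i /andP[/y0/ltW].
apply: (@le_trans _ _ (\sum_(i | Q i) (2 * (N / S) - y i * (N / S) ^+ 2))).
  rewrite sumrB -!mulr_suml -/S sumr_const.
  have -> : #|Q| = (\sum_(i | Q i) 1)%N by rewrite sum1_card.
  rewrite -[_ *+ _]mulr_natr -/N le_eqVlt; apply/orP; left; apply/eqP.
  by field; rewrite lt0r_neq0.
apply: ler_sum => i Qi; have yi := y0 i Qi; move: (N / S) (y i) yi => t z z0.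
rewrite -subr_ge0; have -> : z^-1 - (2 * t - z * t ^+ 2) = z^-1 * (1 - z * t) ^+ 2.
  by field; rewrite lt0r_neq0.
by apply: mulr_ge0; [rewrite invr_ge0 ltW|exact: sqr_ge0].
Qed.

Section Rsum.
Local Open Scope classical_set_scope.
Context {R : realType} {dsp : measure_display} {Omega : measurableType dsp}.
Variable P : probability Omega R.

Lemma integrable_bigsum (I : Type) (s : seq I) (Q : pred I) (f : I -> Omega -> R) :
  (forall i, Q i -> P.-integrable setT (EFin \o f i)) ->
  P.-integrable setT (EFin \o (fun w => \sum_(i <- s | Q i) f i w)).
Proof.
move=> fi; have := integrable_sum measurableT s fi.
by apply: eq_integrable => // w _ /=; rewrite sumEFin.
Qed.

Lemma Rintegral_bigsum (I : Type) (s : seq I) (Q : pred I) (f : I -> Omega -> R) :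
  (forall i, Q i -> P.-integrable setT (EFin \o f i)) ->
  \int[P]_w (\sum_(i <- s | Q i) f i w) = \sum_(i <- s | Q i) \int[P]_w f i w.
Proof.
move=> fi; elim: s => [|i s IH].
  by under eq_Rintegral do rewrite big_nil; rewrite big_nil Rintegral_cst// mul0r.
rewrite big_cons; under eq_Rintegral do rewrite big_cons.
case: ifPn => Qi; last by rewrite IH.
by rewrite RintegralD ?IH//; [exact: fi|exact: integrable_bigsum].
Qed.

End Rsum.

(** * The Poisson model: laws of the counts and finiteness of the risk *)

Section Model.
Variables (R : realType) (n : nat -> nat) (D : nat).
Hypothesis n_ge1 : forall d, (1 <= d <= D)%N -> (1 <= n d)%N.
Context {dsp : measure_display} {Omega : measurableType dsp}.
Variables (P : (idx n D -> R) -> probability Omega R)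
  (X : node n D -> {mfun Omega >-> nat}).
Hypothesis model : hierarchical_poisson_model P X.
Variable lam : idx n D -> R.
Hypothesis lam_gt0 : pos_param lam.

Let x w : node n D -> nat := fun v => X v w.

Lemma poisson_node_sum (Q : pred (node n D)) mu :
  \sum_(v | Q v) subtotal lam (tagged v) = mu ->
  poisson_rv (P lam) (fun w => \sum_(v | Q v) x w v)%N mu.
Proof.
have [indep marg] := model lam_gt0.
have rate0 (v : node n D) : 0 < subtotal lam (tagged v).
  exact: (subtotal_gt0 n_ge1 _ lam_gt0 (ltn_ord (tag v))).
move=> <-; split.
- under eq_fun do rewrite -big_filter; exact: measurable_sum_nat.
- by rewrite sumr_ge0// => v _; exact: ltW.
- move=> k; apply: (poisson_sum (rate := fun v => subtotal lam (tagged v))) => //.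
    by move=> v; exact: ltW.
  by case=> d i j; rewrite [LHS]marg poisson_pmfE//; exact: (rate0 (mknode i)).
Qed.

Lemma subtree_count_poisson d (i : idx n d) : (d <= D)%N ->
  poisson_rv (P lam) (fun w => subtree_count (x w) i)
    ((D.+1 - d)%:R * subtotal lam i).
Proof.
move=> dD; under eq_fun do rewrite subtree_countE.
by apply: poisson_node_sum; rewrite node_rate// leqnn leqW.
Qed.

Lemma below_count_poisson d (i : idx n d) : (d <= D)%N ->
  poisson_rv (P lam) (fun w => below_count (x w) i)
    ((D - d)%:R * subtotal lam i).
Proof.
move=> dD; under eq_fun do rewrite below_countE.
by apply: poisson_node_sum; rewrite node_rate ?subSS// leqnSn ltnS.
Qed.

Lemma ln_shift_integrable T mu (c : R) : poisson_rv (P lam) T mu -> 0 < c ->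
  (P lam).-integrable setT (EFin \o (fun w => ln ((T w)%:R + c))).
Proof.
move=> rvT c0.
(* The bound ln x <= x - 1, at k + c and at its reciprocal, controls both signs; the constant covers
   the two cases. *)
apply: (poisson_integrable (f := fun k => ln (k%:R + c)) (C := 1 + c + c^-1) rvT) => k.
have k0 : 0 <= k%:R :> R by [].
have kc : 0 < k%:R + c by lra.
have ci : 0 < c^-1 by rewrite invr_gt0.
have h1 := ln_le_subr1 kc; rewrite -natr1.
have h2 : - ln (k%:R + c) <= c^-1 - 1.
  rewrite -lnV ?posrE//; apply: le_trans (ln_le_subr1 _) _; first by rewrite invr_gt0.
  by rewrite lerD2r lef_pV2 ?posrE// lerDr.
rewrite ler_norml; apply/andP; split; nra.
Qed.

Lemma KL_integrable a : (forall d, 0 < a d) ->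
  (P lam).-integrable setT (EFin \o (fun w => KL_loss (lambda_hat a (x w)) lam)).
Proof.
move=> a0.
under [X in _.-integrable _ (_ \o X)]eq_fun do rewrite KL_loss_lambda_hat//.
have rv0 := subtree_count_poisson (tt : idx n 0) (leq0n D).
have iC c : (P lam).-integrable setT (EFin \o (fun w : Omega => c : R)).
  exact: finite_measure_integrable_cst.
have iN (f : Omega -> R) : (P lam).-integrable setT (EFin \o f) ->
    (P lam).-integrable setT (EFin \o (fun w => - f w)).
  by move=> /(integrable_scale (-1)); under eq_fun do rewrite mulN1r.
do !apply: integrable_add => //.
- apply: (poisson_integrable (f := fun k => k%:R) (C := 1) rv0) => k.
  by rewrite mul1r ger0_norm// ler_nat.
- apply/iN/integrable_bigsum => d _; apply/integrable_scale/integrable_bigsum => i _.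
  apply: integrable_scale; apply: (ln_shift_integrable (subtree_count_poisson _ _)) => //.
  by rewrite -ltnS.
- apply/integrable_bigsum => d _; apply/integrable_scale/integrable_bigsum => i _.
  apply: integrable_scale; apply: (ln_shift_integrable (below_count_poisson _ _)).
    exact: ltnW.
  by rewrite mulr_gt0// ltr0n n_ge1//=.
Qed.

(** The loss is integrable, so risks can be compared as real integrals. *)
Lemma risk_lambda_hat a : (forall d, 0 < a d) ->
  risk P X (lambda_hat a) lam =
  (\int[P lam]_w KL_loss (lambda_hat a (x w)) lam)%:E.
Proof.
move=> a0; rewrite /risk unlock /Rintegral fineK//.
exact: integrable_fin_num (KL_integrable a0).
Qed.

End Model.

Lemma sum_ord_trunc (V : nmodType) (F : nat -> V) p m : (p <= m)%N ->
  (forall d, (p <= d)%N -> F d = 0) ->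
  \sum_(d < m) F d = \sum_(d < p) F d.
Proof.
move=> pm F0; rewrite -!(big_mkord xpredT F) (@big_cat_nat _ _ _ p)//=.
rewrite [X in _ + X]big_nat_cond [X in _ + X]big1 ?addr0// => d.
by rewrite andbT => /andP[/F0].
Qed.

(* The left-hand side is the loss at a node of intensity [l], the right-hand
   side the gain at its [N] descendants at the depth where [b = A]. *)
Lemma node_inequality (R : realFieldType) (A m N p q c l kappa : R) :
  1 <= A -> 1 <= m -> 2 <= N -> 0 <= p -> 0 < q -> q <= c -> 0 < l ->
  0 <= kappa -> p * (m * A) <= kappa * (q * (A - 1)) ->
  p * ((m * (N * A) - N * A) * (m * (N * A) - 1) *
    (c^-1 / ((c + 1) * l + N * A - 2))) <=
  kappa * ((m * A - A) * ((A - 1) * (N ^+ 2 / (q * l + N * (A - 1))))).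
Proof.
move=> A1 m1 N2 p0 q0 qc l0 k0 H.
have c0 : 0 < c by exact: lt_le_trans qc.
have NA : N <= N * A by rewrite ler_peMr//; lra.
have ql : 0 < q * l by rewrite mulr_gt0.
have qcl : q * l <= (c + 1) * l by rewrite ler_wpM2r//; lra.
have d1 : 0 < (c + 1) * l + N * A - 2 by lra.
have d2 : 0 < q * l + N * (A - 1) by rewrite mulrBr mulr1; lra.
have -> : p * ((m * (N * A) - N * A) * (m * (N * A) - 1) *
    (c^-1 / ((c + 1) * l + N * A - 2))) =
    (m - 1) * A * N * (p * (m * (N * A) - 1) / (c * ((c + 1) * l + N * A - 2))).
  by field; rewrite !lt0r_neq0.
have -> : kappa * ((m * A - A) * ((A - 1) * (N ^+ 2 / (q * l + N * (A - 1))))) =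
    (m - 1) * A * N * (kappa * (N * (A - 1)) / (q * l + N * (A - 1))).
  by field; rewrite lt0r_neq0.
apply: ler_wpM2l; first by rewrite !mulr_ge0//; lra.
rewrite ler_pdivrMr ?mulr_gt0// mulrAC ler_pdivlMr//.
(* The hypothesis with q <= c compares the numerators. For the denominators, q <= c + 1, and N >= 2
   gives N (A - 1) <= N A - 2. *)
apply: (@le_trans _ _ (kappa * (N * (A - 1)) * c * (q * l + N * (A - 1)))).
  apply: ler_wpM2r; first exact: ltW.
  apply: (@le_trans _ _ (N * (kappa * (q * (A - 1))))).
    apply: (@le_trans _ _ (N * (p * (m * A)))); last by rewrite ler_wpM2l//; lra.
    by rewrite mulrBr mulr1; have -> : p * (m * (N * A)) = N * (p * (m * A)); [ring|lra].
  have -> : N * (kappa * (q * (A - 1))) = kappa * (N * (A - 1)) * q by ring.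
  by rewrite ler_wpM2l// !mulr_ge0//; lra.
rewrite -!mulrA; do 3![apply: ler_wpM2l; first lra].
rewrite ler_wpM2l//; first lra.
by rewrite mulrBr mulr1; lra.
Qed.

(** * The change of expected loss between a and b, which stand for a(p + 1) and a(p) *)

Section Compare.
Variables (R : realType) (n : nat -> nat) (D : nat).
Hypothesis n_ge1 : forall d, (1 <= d <= D)%N -> (1 <= n d)%N.
Variables (a b : nat -> R) (p : nat).
Hypotheses (a_gt0 : forall d, 0 < a d) (b_gt0 : forall d, 0 < b d).
Hypothesis pD : (p < D)%N.
Hypothesis ab_eq : forall d, (p < d)%N -> a d = b d.
Hypothesis a_step : forall d, (d < p)%N -> (n d.+1)%:R * a d.+1 = a d.
Hypothesis b_step : forall d, (d < p)%N -> (n d.+1)%:R * b d.+1 = b d.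

(** Beyond depth p the terms cancel, as a and b agree there. For d < p the relation n_{d+1} a_{d+1}
    = a_d, and the same for b, gives the sibling terms the form of [log_ratio]. At d = p they
    involve only depth p + 1 and cancel, so the second sum stops one level earlier. *)
Lemma KL_loss_diff (lam : idx n D -> R) (x : node n D -> nat) :
  pos_param lam ->
  KL_loss (lambda_hat a x) lam - KL_loss (lambda_hat b x) lam =
  a 0 - b 0
  - \sum_(d < p.+1) \sum_(i : idx n d) (D.+1 - d)%:R * subtotal lam i *
      log_ratio (a d) (b d) (subtree_count x i)
  + \sum_(d < p) \sum_(i : idx n d) (D - d)%:R * subtotal lam i *
      log_ratio (a d) (b d) (below_count x i).
Proof.
move=> lam0; rewrite !KL_loss_lambda_hat//.
have E1 : \sum_(d < D.+1) (D.+1 - d)%:R * count_term lam a x d -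
    \sum_(d < D.+1) (D.+1 - d)%:R * count_term lam b x d =
  \sum_(d < p.+1) \sum_(i : idx n d) (D.+1 - d)%:R * subtotal lam i *
      log_ratio (a d) (b d) (subtree_count x i).
  rewrite -sumrB -(@sum_ord_trunc _ (fun d => \sum_(i : idx n d)
     (D.+1 - d)%:R * subtotal lam i * log_ratio (a d) (b d) (subtree_count x i))
     p.+1 D.+1) ?ltnS 1?ltnW//; last first.
    move=> d pd; rewrite big1// => i _; rewrite ab_eq// /log_ratio divff ?ln1 ?mulr0//.
    by rewrite lt0r_neq0// ltr_wpDl.
  apply: eq_bigr => d _; rewrite -mulrBr /count_term -sumrB mulr_sumr.
  apply: eq_bigr => i _; rewrite -mulrBr mulrA /log_ratio ln_div// posrE ltr_wpDl//.
have E2 : \sum_(d < D) (D - d)%:R * sibling_term lam a x d -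
    \sum_(d < D) (D - d)%:R * sibling_term lam b x d =
  \sum_(d < p) \sum_(i : idx n d) (D - d)%:R * subtotal lam i *
      log_ratio (a d) (b d) (below_count x i).
  pose F d := if (d < p)%N then \sum_(i : idx n d) (D - d)%:R * subtotal lam i *
    log_ratio (a d) (b d) (below_count x i) else 0.
  transitivity (\sum_(d < D) F d); last first.
    rewrite (@sum_ord_trunc _ F p D (ltnW pD)).
      by apply: eq_bigr => d _; rewrite /F ltn_ord.
    by move=> d pd; rewrite /F ltnNge pd.
  rewrite -sumrB /F; apply: eq_bigr => d _; rewrite -mulrBr; case: ifPn => [dp|].
    rewrite /sibling_term -sumrB mulr_sumr; apply: eq_bigr => i _.
    by rewrite a_step// b_step// -mulrBr mulrA /log_ratio ln_div// posrE ltr_wpDl.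
  by rewrite -leqNgt => pd; rewrite /sibling_term ab_eq// subrr mulr0.
rewrite -E1 -E2.
by ring.
Qed.

Context {dsp : measure_display} {Omega : measurableType dsp}.
Variables (P : (idx n D -> R) -> probability Omega R)
  (X : node n D -> {mfun Omega >-> nat}).
Hypothesis model : hierarchical_poisson_model P X.
Variable lam : idx n D -> R.
Hypothesis lam_gt0 : pos_param lam.
Hypothesis ba : forall d, b d <= a d.

Let cnt d (i : idx n d) w := subtree_count (X ^~ w) i.
Let below d (i : idx n d) w := below_count (X ^~ w) i.
Let E (f : Omega -> R) := (\int[P lam]_w f w)%R.

Lemma expected_loss_diff :
  E (fun w => KL_loss (lambda_hat a (X ^~ w)) lam) -
  E (fun w => KL_loss (lambda_hat b (X ^~ w)) lam) =
  a 0 - b 0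
  - \sum_(d < p.+1) \sum_(i : idx n d) (D.+1 - d)%:R * subtotal lam i *
      E (fun w => log_ratio (a d) (b d) (cnt i w))
  + \sum_(d < p) \sum_(i : idx n d) (D - d)%:R * subtotal lam i *
      E (fun w => log_ratio (a d) (b d) (below i w)).
Proof.
have iL T mu d : poisson_rv (P lam) T mu ->
    (P lam).-integrable setT (EFin \o (fun w => log_ratio (a d) (b d) (T w))).
  move=> rvT; exact: (bounded_integrable rvT (log_ratio_bounded (ba d) (b_gt0 d))).
have dp1 (d : 'I_p.+1) : (d <= D)%N.
  by rewrite (leq_trans _ (ltnW pD))// -ltnS.
have dp (d : 'I_p) : (d <= D)%N by rewrite (leq_trans (ltnW (ltn_ord d)) (ltnW pD)).
have ic d (i : idx n d) : (d <= D)%N -> (P lam).-integrable setT (EFin \o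
    (fun w => (D.+1 - d)%:R * subtotal lam i * log_ratio (a d) (b d) (cnt i w))).
  by move=> dD; apply/integrable_scale/iL; exact: (subtree_count_poisson n_ge1 model lam_gt0).
have ib d (i : idx n d) : (d <= D)%N -> (P lam).-integrable setT (EFin \o
    (fun w => (D - d)%:R * subtotal lam i * log_ratio (a d) (b d) (below i w))).
  by move=> dD; apply/integrable_scale/iL; exact: (below_count_poisson n_ge1 model lam_gt0).
pose S1 w := \sum_(d < p.+1) \sum_(i : idx n d) (D.+1 - d)%:R * subtotal lam i *
      log_ratio (a d) (b d) (cnt i w).
pose S2 w := \sum_(d < p) \sum_(i : idx n d) (D - d)%:R * subtotal lam i *
      log_ratio (a d) (b d) (below i w).
have i1 : (P lam).-integrable setT (EFin \o S1).
  by apply: integrable_bigsum => d _; apply: integrable_bigsum => i _; exact: ic.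
have i2 : (P lam).-integrable setT (EFin \o S2).
  by apply: integrable_bigsum => d _; apply: integrable_bigsum => i _; exact: ib.
have i3 : (P lam).-integrable setT (EFin \o (fun=> a 0 - b 0 : R)).
  exact: finite_measure_integrable_cst.
have i4 := integrable_add i3 (integrable_scale (-1) i1).
rewrite -RintegralB//; try exact: (KL_integrable n_ge1 model lam_gt0).
transitivity (\int[P lam]_w (a 0 - b 0 + -1 * S1 w + S2 w))%R.
  by apply: eq_Rintegral => w _; rewrite KL_loss_diff// mulN1r.
rewrite (RintegralD measurableT i4 i2) (RintegralD measurableT i3 (integrable_scale (-1) i1)).
rewrite (RintegralZl _ measurableT i1) Rintegral_cst//.
rewrite [X in fine X](_ : _ = 1%E); last exact: probability_setT.
rewrite mulr1 mulN1r; congr (_ - _ + _).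
  rewrite Rintegral_bigsum; last first.
    by move=> d _; apply: integrable_bigsum => i _; exact: ic.
  apply: eq_bigr => d _; rewrite Rintegral_bigsum; last by move=> i _; exact: ic.
  apply: eq_bigr => i _; rewrite RintegralZl//; apply: iL.
  exact: (subtree_count_poisson n_ge1 model lam_gt0).
rewrite Rintegral_bigsum; last first.
  by move=> d _; apply: integrable_bigsum => i _; exact: ib.
apply: eq_bigr => d _; rewrite Rintegral_bigsum; last by move=> i _; exact: ib.
apply: eq_bigr => i _; rewrite RintegralZl//; apply: iL.
exact: (below_count_poisson n_ge1 model lam_gt0).
Qed.

(** [A] is the value of b at depth p; [kappa] is the fraction of the gain at depth p that the
    shallower depths may consume. *)
Variables (A kappa : R).
Hypotheses (A_ge2 : 2 <= A) (n_ge2 : forall d, (1 <= d <= p.+1)%N -> (2 <= n d)%N).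
Hypothesis bE : forall d, (d <= p)%N ->
  b d = (\prod_(d.+1 <= k < p.+1) n k)%:R * A.
Hypothesis aE : forall d, (d <= p)%N -> a d = (n p.+1)%:R * b d.
Hypotheses (kappa_ge0 : 0 <= kappa) (kappa_lt1 : kappa < 1).
Hypothesis kappa_bound :
  p%:R * ((n p.+1)%:R * A) <= kappa * ((D.+1 - p)%:R * (A - 1)).

Let q : R := (D.+1 - p)%:R.
(** The gain at v is at least (a_p - b_p) h(v). *)
Let h (v : idx n p) : R := (A - 1) / (q * subtotal lam v + A - 1).

Lemma expected_loss_lt :
  E (fun w => KL_loss (lambda_hat b (X ^~ w)) lam) <
  E (fun w => KL_loss (lambda_hat a (X ^~ w)) lam).
Proof.
rewrite -subr_gt0 expected_loss_diff big_ord_recr /=.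
have A2 := A_ge2.
have A1 : 1 <= A by lra.
have A10 : 0 <= A - 1 by lra.
have bp : b p = A by rewrite bE// big_geq// mul1r.
have ap : a p = (n p.+1)%:R * A by rewrite aE// bp.
have m2 : 2 <= (n p.+1)%:R :> R by rewrite (ler_nat _ 2) n_ge2/=.
have m1 : 1 <= (n p.+1)%:R :> R by lra.
have q0 : 0 < q by rewrite ltr0n subn_gt0 ltnS ltnW.
have lv d (v : idx n d) : (d <= D)%N -> 0 < subtotal lam v.
  exact: (subtotal_gt0 n_ge1).
have h0 v : 0 < h v.
  have := mulr_gt0 q0 (lv _ v (ltnW pD)) => l0.
  by rewrite /h; move: (q * _) l0 => z z0; apply: divr_gt0; lra.
have d0 : 0 < a p - b p by rewrite ap bp; nra.
have T0 : 0 < \sum_v h v.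
  have [|v _] := @extends_witness n D n_ge1 0 p tt; first by rewrite /= ltnW.
  by rewrite (bigD1 v)//= ltr_wpDr// sumr_ge0// => u _; exact: ltW.
(* Both a_0 and b_0 are n_1 ... n_p times their values at depth p, and depth p has that many
   nodes. *)
have ab0 : a 0 - b 0 = \sum_(v : idx n p) (a p - b p).
  rewrite sumr_const -[_ *+ _]mulr_natl aE// bE// -(card_extends (tt : idx n 0))//.
  rewrite (big_extends_root (fun=> 1%N)) sum1_card ap bp; ring.
have top : (a p - b p) * \sum_v h v <= a 0 - b 0 -
   \sum_(v : idx n p) q * subtotal lam v * E (fun w => log_ratio (a p) (b p) (cnt v w)).
  rewrite ab0 -sumrB mulr_sumr; apply: ler_sum => v _.
  rewrite /h -[X in _ * ((X - 1) / _)]bp -[X in _ * (_ / (_ + X - 1))]bp.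
  apply: log_ratio_lower => //.
  - exact: (subtree_count_poisson n_ge1 model lam_gt0 _ (ltnW pD)).
  - by rewrite mulr_gt0// lv// ltnW.
  - by rewrite bp; lra.
have lower d (i : idx n d) : (d < p)%N ->
  p%:R * ((D.+1 - d)%:R * subtotal lam i * E (fun w => log_ratio (a d) (b d) (cnt i w))
    - (D - d)%:R * subtotal lam i * E (fun w => log_ratio (a d) (b d) (below i w)))
  <= kappa * ((a p - b p) * \sum_(v : idx n p | extends i v) h v).
  move=> dp; have dD : (d < D)%N by exact: ltn_trans pD.
  have li := lv _ i (ltnW dD).
  have c0 : 0 < (D - d)%:R :> R by rewrite ltr0n subn_gt0.
  have cE : (D.+1 - d)%:R = (D - d)%:R + 1 :> R by rewrite subSn ?natr1// ltnW.
  set N : R := (\prod_(d.+1 <= k < p.+1) n k)%:R.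
  have N2 : 2 <= N.
    rewrite /N (ler_nat _ 2) big_ltn ?ltnS//.
    apply: (@leq_trans (n d.+1)); first by rewrite n_ge2//= ltnS ltnW.
    rewrite leq_pmulr// big_nat_cond prodn_cond_gt0// => k.
    rewrite andbT => /andP[dk kp]; apply: n_ge1.
    by rewrite (leq_ltn_trans _ dk)//= (leq_trans _ (ltnW pD)).
  have bd : b d = N * A by rewrite bE// ltnW.
  have ad : a d = (n p.+1)%:R * (N * A) by rewrite aE ?bd// ltnW.
  have up := log_ratio_upper (below_count_poisson n_ge1 model lam_gt0 i (ltnW dD))
    (subtree_count_poisson n_ge1 model lam_gt0 i (ltnW dD)) (a := a d) (b := b d).
  apply: (@le_trans _ _ (p%:R * ((a d - b d) * (a d - 1) *
     ((D - d)%:R^-1 / (((D - d)%:R + 1) * subtotal lam i + N * A - 2))))).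
    rewrite ler_wpM2l//; apply: le_trans (up _ _ _ _ _) _ => //.
    - by rewrite mulr_gt0.
    - by rewrite ler_wpM2r// ?ltW// cE; lra.
    - by move=> w; exact: below_count_le.
    - rewrite bd; nra.
    rewrite -bd le_eqVlt; apply/orP; left; apply/eqP.
    rewrite cE; congr (_ * (_ / _)); field; rewrite !lt0r_neq0//.
  rewrite ad bd; apply: le_trans.
    (* Here c = D - d and q = D + 1 - p; q <= c holds because d < p. *)
    apply: (@node_inequality _ A (n p.+1)%:R N p%:R q (D - d)%:R (subtotal lam i) kappa) => //.
    by rewrite /q ler_nat subSn ?(ltnW pD)// ltn_sub2l.
  rewrite ler_wpM2l// ap bp ler_wpM2l//; first by have := ltW d0; rewrite ap bp.
  rewrite /h -mulr_sumr ler_wpM2l//.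
  have y0 (v : idx n p) : extends i v -> 0 < q * subtotal lam v + A - 1.
    by move=> _; have := mulr_gt0 q0 (lv _ v (ltnW pD)); move: (q * _) => z z0; lra.
  have dpD : (d <= p <= D)%N by rewrite (ltnW dp) (ltnW pD).
  (* The N descendants of i at depth p have total intensity that of i, so their denominators add up
     to q l + N (A - 1), with l the intensity of i. *)
  have := harmonic_sum_ge y0 (extends_witness n_ge1 i dpD).
  rewrite card_extends ?(ltnW dp)// -/N; apply: le_trans.
  rewrite le_eqVlt; apply/orP; left; apply/eqP; congr (_ / _).
  under [RHS]eq_bigr do rewrite -addrA.
  rewrite big_split /= -mulr_sumr sum_subtotal ?(ltnW dp) ?(ltnW pD)//.
  congr (_ + _); rewrite sumr_const -[RHS]mulr_natl; congr (_%:R * _).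
  by rewrite -sum1_card card_extends// ltnW.
have rest : \sum_(d < p) \sum_(i : idx n d)
    (D.+1 - d)%:R * subtotal lam i * E (fun w => log_ratio (a d) (b d) (cnt i w))
  - \sum_(d < p) \sum_(i : idx n d)
    (D - d)%:R * subtotal lam i * E (fun w => log_ratio (a d) (b d) (below i w))
  <= kappa * ((a p - b p) * \sum_v h v).
  (* For p = 0 there is no shallower depth. Otherwise the bounds [lower], which carry a factor p,
     are summed over the p depths. *)
  have [p0|p0] := posnP p.
    have no (d : 'I_p) : False by case: d => d; rewrite p0.
    rewrite big1 => [|d]; last by case: (no d).
    rewrite big1 => [|d]; last by case: (no d).
    by rewrite subr0 !mulr_ge0// ?ltW.
  rewrite -(ler_pM2l (x := p%:R)) ?ltr0n// -sumrB mulr_sumr.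
  have -> : p%:R * (kappa * ((a p - b p) * \sum_v h v)) =
    \sum_(d < p) kappa * ((a p - b p) * \sum_v h v).
    by rewrite sumr_const card_ord mulr_natl.
  apply: ler_sum => d _; rewrite -sumrB mulr_sumr.
  rewrite -(@big_level_tower n _ _ _ d p h); last by rewrite ltnW.
  rewrite !mulr_sumr; apply: ler_sum => i _; exact: lower.
have k1 : kappa * ((a p - b p) * \sum_v h v) < (a p - b p) * \sum_v h v.
  by rewrite gtr_pMl// mulr_gt0.
lra.
Qed.

End Compare.

(** * Product formulas for the hyperparameters *)

Section Hyper.
Variables (R : realType) (D D0 : nat) (n : nat -> nat).
Hypothesis n_ge1 : forall d, (1 <= d <= D)%N -> (1 <= n d)%N.
Hypothesis D0_le : (D0 <= D)%N.

(** The indicator keeps the factors with k <= m and those with k > D0; the latter, with the factor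
    1/2, form the value at depth D0. *)
Lemma hyper_below m d : (m <= D0)%N -> (d < D0)%N ->
  hyper R n D D0 m d = (\prod_(d.+1 <= k < m.+1) n k)%:R *
    (2^-1 * \prod_(D0.+1 <= k < D.+1) (n k)%:R).
Proof.
move=> mD0 dD0; rewrite /hyper dD0 mulrCA; congr (_ * _).
have dD0' : (d.+1 <= D0.+1)%N by rewrite ltnS ltnW.
have D0D' : (D0.+1 <= D.+1)%N by rewrite ltnS.
rewrite (big_cat_nat dD0' D0D') /=; congr (_ * _); last first.
  by apply: eq_big_nat => k /andP[-> _]; rewrite orbT expr1.
rewrite natr_prod.
have expE k : (k < D0.+1)%N -> (n k)%:R ^+ ((k <= m)%N || (D0 < k)%N) =
    (if (k <= m)%N then (n k)%:R else 1) :> R.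
  by rewrite ltnS => kD0; rewrite ltnNge kD0 orbF; case: (k <= m)%N.
rewrite (eq_big_nat _ _ (F2 := fun k => if (k <= m)%N then (n k)%:R else 1));
  last by move=> k /andP[_]; exact: expE.
rewrite -big_mkcond /= [RHS](@big_nat_widen _ _ _ _ _ D0.+1)//.
Qed.

Lemma hyper_gt0 m d : 0 < hyper R n D D0 m d.
Proof.
have n0 k : (d.+1 <= k < D.+1)%N -> 0 < (n k)%:R :> R.
  by move=> /andP[dk kD]; rewrite ltr0n n_ge1// (leq_ltn_trans _ dk).
rewrite /hyper; case: ifP => _; rewrite mulr_gt0 ?invr_gt0// big_nat_cond prodr_gt0//.
  by move=> k; rewrite andbT => /n0 kn; exact: exprn_gt0.
by move=> k; rewrite andbT => /n0.
Qed.

(** At depths below D0 the products up to m and m' are empty; from D0 on, the definition does not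
    involve m. *)
Lemma hyper_above m m' d : (m <= D0)%N -> (m' <= D0)%N -> (m <= d)%N -> (m' <= d)%N ->
  hyper R n D D0 m d = hyper R n D D0 m' d.
Proof.
move=> mD0 mD0' md md'; case: (ltnP d D0) => dD0.
  by rewrite !hyper_below//; congr (_%:R * _); rewrite !big_geq.
by rewrite /hyper ltnNge dD0.
Qed.

Lemma hyper_jeffreys : hyper R n D D0 D0 = jeffreys_hyper R n D.
Proof.
apply/funext => d; rewrite /hyper /jeffreys_hyper; case: ifP => // _; congr (_ * _).
by apply: eq_bigr => k _; rewrite leqNgt orNb expr1.
Qed.

End Hyper.

(* The surplus factor [y / (y - 2)] in the hypothesis yields the factor
   [1 - 2 / y < 1], hence the strictness of the domination. *)
Lemma slack_factor (R : realFieldType) (A m y r p q : R) :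
  2 <= A -> 4 <= y -> 0 <= p -> p * r <= q ->
  m * (y / (y - 2)) <= r * ((A - 1) / A) ->
  p * (m * A) <= (1 - 2 / y) * (q * (A - 1)).
Proof.
move=> A2 y4 p0 prq H.
have y0 : 0 < y / (y - 2) by rewrite divr_gt0//; lra.
have k0 : 0 <= 1 - 2 / y by rewrite subr_ge0 ler_pdivrMr; lra.
apply: (@le_trans _ _ ((1 - 2 / y) * (p * r * (A - 1)))); last first.
  by rewrite ler_wpM2l// ler_wpM2r//; lra.
have -> : (1 - 2 / y) * (p * r * (A - 1)) =
  p * A * ((1 - 2 / y) * (r * ((A - 1) / A))) by field; rewrite !lt0r_neq0//; lra.
rewrite [p * (m * A)](_ : _ = p * A * ((1 - 2 / y) * (m * (y / (y - 2))))); last first.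
  by field; rewrite !lt0r_neq0//; lra.
by rewrite ler_wpM2l ?mulr_ge0// ?ler_wpM2l//; lra.
Qed.

Theorem theorem4p2 (R : realType) (D D0 : nat) (n : nat -> nat)
    (n_ge1 : forall d, (1 <= d <= D)%N -> (1 <= n d)%N)
    (dsp : measure_display) (Omega : measurableType dsp)
    (P : (idx n D -> R) -> probability Omega R)
    (X : node n D -> {mfun Omega >-> nat})
    (model : hierarchical_poisson_model P X)
    (D0_range : (1 <= D0 <= D)%N)
    (aD0 : R)
    (aD0_def : aD0 = 2^-1 * \prod_(D0.+1 <= d' < D.+1) (n d')%:R)
    (n_ge2 : forall D', (1 <= D' <= D0)%N -> (2 <= n D')%N)
    (aD0_ge2 : 2 <= aD0)
    (n_bound : forall D', (2 <= D' <= D0)%N ->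
       (n D')%:R * ((n D'.-1)%:R * aD0 / ((n D'.-1)%:R * aD0 - 2)) <=
       (2 + D%:R - D0%:R) / (D0%:R - 1) * ((aD0 - 1) / aD0)) :
  (forall D', (1 <= D' <= D0)%N ->
     risk_dominated_by P X (lambda_hat (hyper R n D D0 D'))
                      (lambda_hat (hyper R n D D0 D'.-1))) /\
  risk_dominated_by P X (lambda_hat (jeffreys_hyper R n D))
                   (lambda_hat (hyper R n D D0 0)).
Proof.
have /andP[D0_ge1 D0_le] := D0_range.
(* Strictness at every parameter is more than domination asks, and allows the comparisons to be
   chained. *)
have strict m lam : (1 <= m <= D0)%N -> pos_param lam ->
    (risk P X (lambda_hat (hyper R n D D0 m.-1)) lam <
     risk P X (lambda_hat (hyper R n D D0 m)) lam)%E.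
  case: m => // p /= pD0 lam0.
  have hE j d : (j <= D0)%N -> (d < D0)%N -> hyper R n D D0 j d =
      (\prod_(d.+1 <= k < j.+1) n k)%:R * aD0.
    by move=> jD0 dD0; rewrite hyper_below// aD0_def.
  have h0 j := hyper_gt0 R D0 n_ge1 j.
  have step j d : (j <= D0)%N -> (d < j)%N -> (d.+1 < D0)%N ->
      (n d.+1)%:R * hyper R n D D0 j d.+1 = hyper R n D D0 j d.
    move=> jD0 dj dD0; rewrite !hE//; last exact: ltnW.
    by rewrite [in RHS]big_ltn ?ltnS// natrM mulrA.
  have aE d : (d <= p)%N -> hyper R n D D0 p.+1 d = (n p.+1)%:R * hyper R n D D0 p d.
    move=> dp; rewrite !hE// ?(leq_ltn_trans dp)// 1?ltnW//.
    by rewrite big_nat_recr//= natrM mulrAC mulrC.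
  have ab d : (p < d)%N -> hyper R n D D0 p.+1 d = hyper R n D D0 p d.
    by move=> pd; apply: hyper_above => //; exact: ltnW.
  rewrite !(risk_lambda_hat n_ge1 model lam0)// lte_fin.
  have n2 : 2 <= (n p.+1)%:R :> R by rewrite (ler_nat _ 2) n_ge2/=.
  have ba d : hyper R n D D0 p d <= hyper R n D D0 p.+1 d.
    have [dp|dp] := leqP d p; last by rewrite ab.
    by rewrite aE// ler_peMl ?ltW//; lra.
  (* For p = 0 nothing has to be absorbed. Otherwise y = n_p a_{D0} is at least 4, and
     [slack_factor] provides kappa = 1 - 2 / y. *)
  have [kappa [k0 k1 kH]] : exists kappa, [/\ 0 <= kappa, kappa < 1 &
      p%:R * ((n p.+1)%:R * aD0) <= kappa * ((D.+1 - p)%:R * (aD0 - 1))].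
    have [p0|p0] := posnP p.
      by exists 0; rewrite p0 !mul0r.
    have np2 : 2 <= (n p)%:R :> R by rewrite (ler_nat _ 2) n_ge2// p0 ltnW.
    have y4 : 4 <= (n p)%:R * aD0 by nra.
    exists (1 - 2 / ((n p)%:R * aD0)); split.
    - by rewrite subr_ge0 ler_pdivrMr; lra.
    - by rewrite gtrBl divr_gt0//; lra.
    (* With r = (2 + D - D0) / (D0 - 1), the inequality p r <= D + 1 - p follows from p <= D0 -
       1. *)
    apply: slack_factor (n_bound p.+1 _) => //; last by rewrite ltnS p0.
    have pD0R : p%:R <= D0%:R - 1 :> R by rewrite lerBrDr natr1 ler_nat.
    have p1 : 1 <= p%:R :> R by rewrite ler1n.
    have DR : D0%:R <= D%:R :> R by rewrite ler_nat.
    rewrite natrB; last by rewrite leqW// (leq_trans (ltnW pD0)).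
    rewrite -natr1 mulrA ler_pdivrMr; last lra.
    nra.
  apply: (@expected_loss_lt R n D n_ge1 _ _ p (h0 _) (h0 _) _ ab _ _ _ _ _ _
    model _ lam0 ba aD0 kappa) => //.
  - exact: leq_trans D0_le.
  - by move=> d dp; apply: step => //; [exact: ltnW|exact: leq_ltn_trans pD0].
  - by move=> d dp; apply: step => //; [exact: ltnW|exact: leq_ltn_trans pD0].
  - by move=> d /andP[d1 dp]; rewrite n_ge2// d1 (leq_trans dp).
  - by move=> d dp; rewrite hE// ?(leq_ltn_trans dp)// ltnW.
have lam1 : pos_param (fun _ : idx n D => 1 : R) by move=> i; exact: ltr01.
have dominated m m' : (forall lam, pos_param lam ->
    (risk P X (lambda_hat (hyper R n D D0 m')) lam <
     risk P X (lambda_hat (hyper R n D D0 m)) lam)%E) ->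
    risk_dominated_by P X (lambda_hat (hyper R n D D0 m))
                      (lambda_hat (hyper R n D D0 m')).
  move=> H; split=> [lam lam0|]; first by apply/ltW/H.
  by exists (fun=> 1) => //; exact: H.
split=> [m m_range|]; first by apply: dominated => lam; exact: strict.
rewrite -(hyper_jeffreys R D D0 n); apply: dominated => lam lam0.
(* The Jeffreys prior is the case D' = D0; composing the strict steps for D' = 1, ..., D0 links it
   to D' = 0. *)
have chain m : (1 <= m <= D0)%N ->
    (risk P X (lambda_hat (hyper R n D D0 0)) lam <
     risk P X (lambda_hat (hyper R n D D0 m)) lam)%E.
  elim: m => // -[|m] IH mD0; first exact: (strict 1%N).
  apply: lt_trans (IH _) (strict m.+2 _ mD0 lam0).
  exact: ltnW mD0.
by apply: chain; rewrite D0_ge1 leqnn.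
Qed.
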